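(* Let $c^1,\dots,c^k\in\mathbb{R}^d$ be any set of centers, $\delta\in(0,1)$, and let $\mathcal{T}$ be the (random) threshold tree output by the Threshold Tree Construction algorithm described in the context. Then for every $x\in\mathbb{R}^d$, $$\mathbf{E}\big[\|x-\mathcal{T}(x)\|_2^2\big]\le O\!\left(\tfrac{1}{\delta}\log^2 k\,\log\log k\right)\min_{c\in\{c^1,\dots,c^k\}}\|x-c\|_2^2,$$ where the constant in $O(\cdot)$ is absolute.
   Context: Threshold tree: rooted binary tree of cells of $\mathbb{R}^d$, root $=\mathbb{R}^d$; an internal node $u$ split by cut $(i,\xi)$ has children $u_{left}=\{y\in u:y_i\le\xi\}$, $u_{right}=\{y\in u: y_i>\xi\}$. A median of a finite nonempty set $S\subset\mathbb{R}^d$ is a point $m$ such that for every coordinate $i$ each of $\{c\in S:c_i<m_i\}$ and $\{c\in S: c_i>m_i\}$ has at most $|S|/2$ elements. Algorithm (input $C=\{c^1,\dots,c^k\}$, $\delta$): set $\varepsilon=\min\{\delta/(15\ln k),1/320\}$. Start with $\mathcal{T}_1$ consisting of a root $r$ with assigned center set $C_r=C$. For $t=1,2,\dots$, while some leaf of $\mathcal{T}_t$ has at least two centers assigned: sample independently $i_t$ uniform in $\{1,\dots,d\}$, $\theta_t$ uniform in $(0,1)$, $\sigma_t$ uniform in $\{\pm1\}$; for every leaf $u$ of $\mathcal{T}_t$ with $|C_u|\ge2$ apply Divide-and-Share with $(i,\theta,\sigma)=(i_t,\theta_t,\sigma_t)$; the resulting tree is $\mathcal{T}_{t+1}$. Divide-and-Share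 on $u$: let $m^u$ be a median of $C_u$, $R_u=\max_{c\in C_u}\|c-m^u\|_2$, $Left=\{c\in C_u: c_i\le m^u_i+(\sigma+\varepsilon)\sqrt{\theta}R_u\}$, $Right=\{c\in C_u: c_i\ge m^u_i+(\sigma-\varepsilon)\sqrt\theta R_u\}$. If both are nonempty, split $u$ by the cut $(i,\,m^u_i+\sigma\sqrt\theta R_u)$ and assign $Left$ to $u_{left}$ and $Right$ to $u_{right}$; otherwise leave $u$ unchanged. In the output tree $\mathcal{T}$ each leaf has exactly one assigned center, and $\mathcal{T}(y)$ is the center of the leaf containing $y$. *)

(* Defs.v *)
From HB Require Import structures.
From mathcomp Require Import all_boot all_order all_algebra.
From mathcomp Require Import all_classical all_reals all_analysis.

Set Implicit Arguments.
Unset Strict Implicit.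
Unset Printing Implicit Defensive.

Import Order.TTheory GRing.Theory Num.Theory.
Local Open Scope ring_scope.

Section Tree.
Variables (R : realType) (d k : nat).

Definition sqdist (x y : 'rV[R]_d) : R := \sum_(i < d) (x ord0 i - y ord0 i) ^+ 2.
Definition dist2 (x y : 'rV[R]_d) : R := Num.sqrt (sqdist x y).

(* m is a median of the (finite, nonempty) point set {c j | j in S}
   (centers are distinct, so counting indices = counting points). *)
Definition is_median (c : 'I_k -> 'rV[R]_d) (S : {set 'I_k}) (m : 'rV[R]_d) :=
  forall i : 'I_d,
    (2 * #|[set j in S | (c j ord0 i < m ord0 i)%R]| <= #|S|)%N /\
    (2 * #|[set j in S | (c j ord0 i > m ord0 i)%R]| <= #|S|)%N.

(* Threshold trees; each leaf carries its assigned set of centers (indices).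
   TNode i xi l r : cut (i, xi), l = {y_i <= xi}, r = {y_i > xi}. *)
Inductive ttree : Type :=
| TLeaf : {set 'I_k} -> ttree
| TNode : 'I_d -> R -> ttree -> ttree -> ttree.

Variables (c : 'I_k -> 'rV[R]_d) (med : {set 'I_k} -> 'rV[R]_d) (eps : R).

Definition divide_and_share (S : {set 'I_k}) (i : 'I_d) (theta sigma : R) : ttree :=
  let m := med S in
  let Ru := \big[Num.max/0]_(j in S) dist2 (c j) m in
  let Lft := [set j in S | c j ord0 i <= m ord0 i + (sigma + eps) * Num.sqrt theta * Ru] in
  let Rgt := [set j in S | c j ord0 i >= m ord0 i + (sigma - eps) * Num.sqrt theta * Ru] in
  if (0 < #|Lft|)%N && (0 < #|Rgt|)%N
  then TNode i (m ord0 i + sigma * Num.sqrt theta * Ru) (TLeaf Lft) (TLeaf Rgt)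
  else TLeaf S.

Fixpoint round (i : 'I_d) (theta sigma : R) (T : ttree) : ttree :=
  match T with
  | TLeaf A => if (2 <= #|A|)%N then divide_and_share A i theta sigma else TLeaf A
  | TNode j xi l r => TNode j xi (round i theta sigma l) (round i theta sigma r)
  end.

Fixpoint halted (T : ttree) : bool :=
  match T with
  | TLeaf A => (#|A| < 2)%N
  | TNode _ _ l r => halted l && halted r
  end.

Fixpoint leaf_of (T : ttree) (y : 'rV[R]_d) : {set 'I_k} :=
  match T with
  | TLeaf A => A
  | TNode i xi l r => if y ord0 i <= xi then leaf_of l y else leaf_of r y
  end.

Definition tree_cost (T : ttree) (x : 'rV[R]_d) : \bar R :=
  match [pick j in leaf_of T x] with
  | Some j => (sqdist x (c j))%:E
  | None => +oo%E
  end.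

End Tree.

Arguments TLeaf {R d k}.

Section Run.
Variables (R : realType) (d k : nat) (dO : measure_display) (Omega : measurableType dO).
Variables (c : 'I_k -> 'rV[R]_d) (med : {set 'I_k} -> 'rV[R]_d) (eps : R).
Variables (I : nat -> Omega -> 'I_d) (Th : nat -> Omega -> R) (Sg : nat -> Omega -> bool).

Definition sign_of (b : bool) : R := if b then 1 else -1.

(* tree T_{n+1} (after n rounds), root assigned all centers *)
Fixpoint tree_at (n : nat) (w : Omega) : ttree R d k :=
  match n with
  | 0 => TLeaf [set: 'I_k]
  | n'.+1 => round c med eps (I n' w) (Th n' w) (sign_of (Sg n' w)) (tree_at n' w)
  end.

Definition output_cost (x : 'rV[R]_d) (w : Omega) : \bar R :=
  match pselect (exists n, halted (tree_at n w)) with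
  | left h => tree_cost c (tree_at (ex_minn h) w) x
  | right _ => +oo%E
  end.

End Run.

(* Main.v *)
(* Follow the center set [A] of the leaf containing [x]: under a random round it
   is a Markov chain on finite sets.  The [2n]-th root of the power sum of all
   pairwise distances in [A], with [n] of order [ln k], is within a factor 2 of
   the diameter and shrinks by a factor [1 - 1/O(d ln k)] per round in
   expectation.  Losing a center at distance [rho] from [x] has probability
   [O(rho / (d r))] when the cell radius is [r], which gives a first bound
   [O(rho * diameter * ln k)] on the expected extra cost.  For the nearest
   center, a cut [t] between [x] and that center which separates them in spite
   of sharing is within [O(a / eps)] of the median, [a] being the coordinate
   displacement, so the cut density there is [O(a / (eps d r^2))].  After such
   a cut the new nearest center is at some distance [rho(t)] that only grows as
   [A] shrinks; by the first bound the loss is [min(r^2, rho(t) r ln k)], so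
   only the scales [r] between [rho(t)] and [rho(t) ln k] matter.  A logarithmic
   potential pays for them and contributes the factor [ln ln k]. *)
Require Import Defs.
From HB Require Import structures.
From mathcomp Require Import all_boot all_order all_algebra.
From mathcomp Require Import all_classical all_reals all_analysis.
From mathcomp Require Import measurable_realfun ring lra zify.
Import Order.TTheory GRing.Theory Num.Theory.
Local Open Scope ring_scope.

Set Implicit Arguments.
Unset Strict Implicit.
Unset Printing Implicit Defensive.

(** * Finite-state Markov chains *)

(** The number [sigma * theta] is uniform on [(-1, 1)]. Without sharing, two centers with
    coordinates [u <= v], measured from the median in units of the radius, are thus cut apart in
    that coordinate with probability [(v |v| - u |u|) / 2], which is at least [(v - u)^2 / 4]; the
    sum over coordinates is a squared distance. The diameter itself has no usable one-step
    inequality: many pairs can realize it, and separating one of them does not shrink it. A power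
    sum is linear in the pairs, and concavity of the root carries the estimate over to [spread]. The
    obstacle for the nearest center is that the cost after its loss depends on where the cut fell.
    What a separating cut keeps is [A :&: J], where [J] depends on the coordinate, the side of [x]
    and the shifted cut position, not otherwise on the cell. Hence positions can be classified by
    [J] once and for all, and each class is an interval. The loss probabilities are bounded by
    displacement times length of the class, and these weights add up to the squared distance from
    [x] to the center, however many classes there are. *)

Section FiniteValued.
Local Open Scope classical_set_scope.
Variables (R : realType) (dO : measure_display) (Omega : measurableType dO).
Variables (E : finType) (Y : Omega -> E).
Hypothesis mY : forall e, measurable (Y @^-1` [set e]).

Lemma measurable_preimage_pred (Q : pred E) : measurable [set w | Q (Y w)].
Proof.
rewrite (_ : [set w | Q (Y w)] = \bigcup_(e in [set e | Q e]) (Y @^-1` [set e])).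
  by apply: fin_bigcup_measurable => // e _; exact: mY.
apply/seteqP; split => w /=; first by move=> qw; exists (Y w).
by case=> e /= qe eY; rewrite eY.
Qed.

Lemma measure_preimage_pred (mu : {measure set Omega -> \bar R}) (D : set Omega)
    (Q : pred E) : measurable D ->
  (mu (D `&` [set w | Q (Y w)]) = \sum_(e | Q e) mu (D `&` (Y @^-1` [set e])))%E.
Proof.
move=> mD; rewrite -big_filter.
set s := [seq _ <- _ | _].
rewrite (_ : [set w | Q (Y w)] = [set w | Y w \in s]); last first.
  by apply/seteqP; split => w /=; rewrite mem_filter mem_index_enum andbT.
have : uniq s by rewrite filter_uniq// index_enum_uniq.
elim: s => [|e s IH] /=.
  by rewrite big_nil (_ : [set w | _] = set0) ?setI0 ?measure0//; apply/seteqP; split.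
case/andP => es us; rewrite big_cons -IH//.
rewrite (_ : [set w | Y w \in e :: s] = Y @^-1` [set e] `|` [set w | Y w \in s]); last first.
  apply/seteqP; split => w /=; rewrite inE; first by case/orP => [/eqP|]; [left|right].
  by case=> [->|->]; rewrite ?eqxx ?orbT.
rewrite setIUr measureU//.
- by apply: measurableI => //; exact: mY.
- by apply: measurableI => //; exact: measurable_preimage_pred.
- apply/seteqP; split => w //= [[_ ->] [_]] es'.
  by rewrite es' in es.
Qed.

Lemma expectation_fin (P : probability Omega R) (F : E -> R) :
  (forall e, 0 <= F e) ->
  (\int[P]_w (F (Y w))%:E = (\sum_e F e * fine (P (Y @^-1` [set e])))%:E)%E.
Proof.
move=> F0.
under eq_integral => w _.
  rewrite (_ : (F (Y w))%:E = (\sum_e (F e)%:E * (\1_(Y @^-1` [set e]) w)%:E)%E); last first.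
    rewrite (bigD1 (Y w))//= big1 ?adde0; last first.
      move=> e /eqP ne; rewrite indicE memNset ?mule0//= => ?; exact: ne.
    by rewrite indicE mem_set//= mule1.
  over.
rewrite ge0_integral_sum//; last 2 first.
- move=> e; apply: measurable_funeM.
  by apply/measurable_EFinP; apply: measurable_indic; exact: mY.
- by move=> e w _; apply: mule_ge0; rewrite lee_fin// indicE.
rewrite -sumEFin; apply: eq_bigr => e _.
rewrite ge0_integralZl_EFin//; last first.
- by apply/measurable_EFinP; apply: measurable_indic; exact: mY.
- rewrite integral_indic//.
  by rewrite setIT EFinM fineK// fin_num_measure.
Qed.

End FiniteValued.

(** * Expectations along a chain driven by independent outcomes *)

Section MarkovIteration.
Local Open Scope classical_set_scope.
Variables (R : realType) (dO : measure_display) (Omega : measurableType dO).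
Variables (P : probability Omega R) (O : finType) (p : O -> R) (o : nat -> Omega -> O).
Hypothesis mo : forall t e, measurable (o t @^-1` [set e]).
Hypothesis p0 : forall e, 0 <= p e.
Hypothesis iid : forall (n : nat) (e : nat -> O),
  P (\bigcap_(t in `I_n) (o t @^-1` [set e t])) = (\prod_(t < n) p (e t))%:E.
Variables (S : Type) (step : S -> O -> S) (s0 : S).

Fixpoint chain n w : S := if n is m.+1 then step (chain m w) (o m w) else s0.

(** The state space [S] may be infinite. Events about the chain become events about the tuple of
    past outcomes, which takes finitely many values. *)
Let hist n w : n.-tuple O := [tuple o i w | i < n].

Let chain_hist n w : chain n w = foldl step s0 (hist n w).
Proof.
have -> : (hist n w : seq O) = [seq o i w | i <- iota 0 n].
  by rewrite /= -val_enum_ord -map_comp.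
elim: n => // n IH.
by rewrite -addn1 iotaD map_cat foldl_cat/= add0n addn1 -IH.
Qed.

Let histE n (h : n.-tuple O) o0 :
  hist n @^-1` [set h] = \bigcap_(t in `I_n) (o t @^-1` [set nth o0 h t]).
Proof.
apply/seteqP; split => w /=.
  move=> <- t /= tn.
  by have := tnth_mktuple (fun i : 'I_n => o i w) (Ordinal tn); rewrite (tnth_nth o0) => <-.
move=> H; apply: eq_from_tnth => i; rewrite tnth_mktuple (tnth_nth o0).
by apply: H => /=.
Qed.

Let mhist n (h : n.-tuple O) : measurable (hist n @^-1` [set h]).
Proof.
have [->//|/set0P[w _]] := eqVneq (hist n @^-1` [set h]) set0.
by rewrite (histE h (o 0 w)); apply: fin_bigcap_measurable.
Qed.

Let next n w := (hist n w, o n w).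

Let nextE n h e :
  next n @^-1` [set (h, e)] = (hist n @^-1` [set h]) `&` (o n @^-1` [set e]).
Proof. by apply/seteqP; split => w /=; rewrite /next => -[hE eE]; [split|rewrite hE eE]. Qed.

Let nextP n h e : fine (P (next n @^-1` [set (h, e)])) = fine (P (hist n @^-1` [set h])) * p e.
Proof.
have hE := histE h e.
(* [f] is the history [h] continued by the constant [e], so that the events for [n] and for [n.+1]
   rounds are both instances of [iid]. *)
pose f t := if (t < n)%N then nth e h t else e.
have -> : hist n @^-1` [set h] = \bigcap_(t in `I_n) (o t @^-1` [set f t]).
  by rewrite hE; apply: eq_bigcapr => t /= tn; rewrite /f tn.
rewrite nextE.
have -> : (hist n @^-1` [set h]) `&` (o n @^-1` [set e]) =
          \bigcap_(t in `I_n.+1) (o t @^-1` [set f t]).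
  rewrite hE; apply/seteqP; split => w /=.
    move=> [H oe] t; rewrite /= ltnS leq_eqVlt => /orP[/eqP->|tn]; rewrite /= /f.
      by rewrite ltnn.
    by rewrite tn; exact: H.
  move=> H; split; last by have := H n (ltnSn n); rewrite /= /f ltnn.
  by move=> t /= tn; have := H t (ltnW tn); rewrite /= /f tn.
have fn : f n = e by rewrite /f ltnn.
by rewrite !iid/= big_ord_recr/= fn.
Qed.

Lemma measurable_chain_pred n (Q : S -> bool) : measurable [set w | Q (chain n w)].
Proof.
have := @measurable_preimage_pred _ _ _ (hist n) (@mhist n) (fun h => Q (foldl step s0 h)).
by congr measurable; apply/seteqP; split => w /=; rewrite chain_hist.
Qed.

Lemma measurable_chain_fun n (F : S -> R) : measurable_fun setT (fun w => (F (chain n w))%:E).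
Proof.
move=> _ B _; rewrite setTI.
have := measurable_chain_pred n (fun s => `[< B (F s)%:E >]).
by congr measurable; apply/seteqP; split => w /= /asboolP.
Qed.

(** Independence of the next outcome from the history lets the one-step inequality be applied at
    each history and summed. The value [g = 1] serves the superharmonic potential, [g < 1] serves
    halting. *)
Lemma chain_expectation_le (U : S -> R) (g : R) (n : nat) : 0 <= g ->
  (forall s, 0 <= U s) -> (forall s, \sum_e p e * U (step s e) <= g * U s) ->
  (\int[P]_w (U (chain n w))%:E <= (g ^+ n * U s0)%:E)%E.
Proof.
move=> g0 U0 H; elim: n => [|n IH].
  rewrite /= expr0 mul1r (@integral_cst _ _ _ P setT measurableT (U s0)%:E).
  by rewrite [X in (_ * X)%E](_ : _ = 1%E) ?mule1//; exact: probability_setT.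
pose F (he : n.-tuple O * O) := U (step (foldl step s0 he.1) he.2).
rewrite (eq_integral (fun w => (F (next n w))%:E)); last first.
  by move=> w _; rewrite /F /= chain_hist.
have mn : forall he, measurable (next n @^-1` [set he]).
  by move=> [h e]; rewrite nextE; apply: measurableI; [exact: mhist|exact: mo].
rewrite (expectation_fin mn); last by move=> ?; exact: U0.
rewrite (eq_integral (fun w => (U (foldl step s0 (hist n w)))%:E)) in IH; last first.
  by move=> w _; rewrite chain_hist.
rewrite (@expectation_fin _ _ _ _ (hist n) (@mhist n) P (fun h => U (foldl step s0 h))) in IH; last first.
  by move=> h; exact: U0.
rewrite lee_fin in IH; rewrite lee_fin exprS -mulrA.
apply: le_trans (ler_wpM2l g0 IH).
rewrite (eq_bigr (fun he => F (he.1, he.2) * fine (P (next n @^-1` [set (he.1, he.2)]))));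
  last by case.
rewrite -(pair_bigA _ (fun h e => F (h, e) * fine (P (next n @^-1` [set (h, e)]))))/=.
rewrite mulr_sumr; apply: ler_sum => h _.
under eq_bigr => e _ do rewrite nextP /F/= [fine _ * _]mulrC mulrA [U _ * _]mulrC.
by rewrite -mulr_suml mulrA ler_wpM2r// fine_ge0.
Qed.

End MarkovIteration.

(** * Outcomes of a round *)

Section Outcome.
Variables (R : realType) (d k : nat) (c : 'I_k -> 'rV[R]_d) (med : {set 'I_k} -> 'rV[R]_d).
Variables (eps : R) (x : 'rV[R]_d).

Definition cell_radius (A : {set 'I_k}) : R := \big[Num.max/0]_(j in A) dist2 (c j) (med A).

(** All centers are tested, not only those of [A]: the set then depends on [A] solely through the
    shifted cut position, and can be compared across cells. *)
Definition low_centers (A : {set 'I_k}) (i : 'I_d) (s th : R) : {set 'I_k} :=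
  [set j | c j ord0 i <= med A ord0 i + (s + eps) * Num.sqrt th * cell_radius A].

Definition high_centers (A : {set 'I_k}) (i : 'I_d) (s th : R) : {set 'I_k} :=
  [set j | c j ord0 i >= med A ord0 i + (s - eps) * Num.sqrt th * cell_radius A].

Definition below_cut (A : {set 'I_k}) (i : 'I_d) (s th : R) : bool :=
  x ord0 i <= med A ord0 i + s * Num.sqrt th * cell_radius A.

(* Everything a round reveals about the assigned sets and about the side of
   [x], for all potential current sets at once: this is a finite type. *)
Definition observation := {ffun {set 'I_k} -> {set 'I_k} * {set 'I_k} * bool}.
Definition outcome := ('I_d * bool * observation)%type.

Definition observe (i : 'I_d) (s th : R) : observation :=
  [ffun A => (low_centers A i s th, high_centers A i s th, below_cut A i s th)].

Definition outcome_of (i : 'I_d) (b : bool) (th : R) : outcome :=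
  (i, b, observe i (sign_of R b) th).

Definition low (o : outcome) (A : {set 'I_k}) := (o.2 A).1.1.
Definition high (o : outcome) (A : {set 'I_k}) := (o.2 A).1.2.
Definition xside (o : outcome) (A : {set 'I_k}) := if (o.2 A).2 then low o A else high o A.

Definition splits (o : outcome) (A : {set 'I_k}) :=
  [&& (2 <= #|A|)%N, A :&: low o A != finset.set0 & A :&: high o A != finset.set0].

Definition next_set (A : {set 'I_k}) (o : outcome) :=
  if splits o A then A :&: xside o A else A.

(** The law of an outcome, written without [Omega], so that every one-step estimate is a finite sum;
    [random_outcome_iid] identifies it with the actual law. *)
Definition weight (o : outcome) : R :=
  d%:R^-1 * (2^-1 * fine (lebesgue_measure
    ((observe o.1.1 (sign_of R o.1.2) @^-1` [set o.2]) `&` `]0, 1[)%classic)).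

Local Open Scope classical_set_scope.

Let measurable_threshold (m a r : R) :
  measurable_fun setT (fun th : R => m + a * Num.sqrt th * r).
Proof.
apply: measurable_funD => //; apply: measurable_funM => //; apply: measurable_funM => //.
by apply: continuous_measurable_fun => ?; exact: sqrt_continuous.
Qed.

Let measurable_bool (b : bool) (f : R -> bool) :
  measurable [set th | f th] -> measurable [set th | f th = b].
Proof.
case: b => // mf; rewrite (_ : [set th | f th = false] = ~` [set th | f th]).
  exact: measurableC.
by apply/seteqP; split => th /=; case: (f th).
Qed.

Let measurable_le_threshold (y m a r : R) :
  measurable [set th : R | y <= m + a * Num.sqrt th * r].
Proof.
rewrite (_ : [set _ | _] = setT `&` (fun th : R => m + a * Num.sqrt th * r) @^-1` `[y, +oo[).
  by apply: measurable_threshold => //; exact: measurable_itv.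
by apply/seteqP; split => th /=; rewrite in_itv/= andbT // => -[].
Qed.

Let measurable_ge_threshold (y m a r : R) :
  measurable [set th : R | y >= m + a * Num.sqrt th * r].
Proof.
rewrite (_ : [set _ | _] = setT `&` (fun th : R => m + a * Num.sqrt th * r) @^-1` `]-oo, y]).
  by apply: measurable_threshold => //; exact: measurable_itv.
by apply/seteqP; split => th /=; rewrite in_itv/= // => -[].
Qed.

Let measurable_finset (f : 'I_k -> R -> bool) (J : {set 'I_k}) :
  (forall j, measurable [set th | f j th]) -> measurable [set th | [set j | f j th]%SET = J].
Proof.
move=> mf.
rewrite (_ : [set th | _ = J] = \bigcap_(j in setT) [set th | f j th = (j \in J)]).
  apply: fin_bigcap_measurable => [|j _]; [exact: finite_finset|exact: measurable_bool].
apply/seteqP; split => th /=; first by move=> <- j _; rewrite /= inE.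
by move=> H; apply/setP => j; rewrite inE; exact: H.
Qed.

Lemma measurable_observe i s f : measurable (observe i s @^-1` [set f]).
Proof.
rewrite (_ : _ @^-1` _ = \bigcap_(A in setT)
  ([set th | low_centers A i s th = (f A).1.1] `&` [set th | high_centers A i s th = (f A).1.2]
   `&` [set th | below_cut A i s th = (f A).2])).
  apply: fin_bigcap_measurable => [|A _]; first exact: finite_finset.
  apply: measurableI; last by apply: measurable_bool; exact: measurable_le_threshold.
  apply: measurableI; apply: measurable_finset => j.
    exact: measurable_le_threshold.
  exact: measurable_ge_threshold.
apply/seteqP; split => th /=; first by move=> <- A _; rewrite /= ffunE.
move=> H; apply/ffunP => A; rewrite ffunE; have [[-> ->] ->] := H A Logic.I.
by case: (f A) => -[].
Qed.

Lemma lebesgue_le_length (Q : set R) (lo hi : R) : measurable Q -> lo <= hi ->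
  Q `<=` `[lo, hi] -> (lebesgue_measure Q <= (hi - lo)%:E)%E.
Proof.
move=> mQ lh QI; apply: (@le_trans _ _ (lebesgue_measure `[lo, hi])).
  by apply: le_measure => //; rewrite inE//; exact: measurable_itv.
rewrite lebesgue_measure_itv/= lte_fin; case: ltP => // _.
by rewrite lee_fin subr_ge0.
Qed.

Let mu01 (Q : set R) := fine (lebesgue_measure (Q `&` `]0, 1[)).

Let fin01 (Q : set R) : measurable Q -> lebesgue_measure (Q `&` `]0, 1[) \is a fin_num.
Proof.
move=> mQ; rewrite ge0_fin_numE//.
apply: (@le_lt_trans _ _ (lebesgue_measure (`[0, 1] : set R))).
  apply: le_measure; [apply: mem_set; apply: measurableI => //|exact: mem_set|].
  by move=> r [_] /=; rewrite !in_itv/= => /andP[/ltW -> /ltW ->].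
by rewrite lebesgue_measure_itv/= lte_fin ltr01 -EFinB ltry.
Qed.

Lemma weight_ge0 o : 0 <= weight o.
Proof. by rewrite /weight mulr_ge0// ?invr_ge0// mulr_ge0// ?invr_ge0// fine_ge0. Qed.

Let sum_mu01 i s (Q : pred observation) :
  \sum_(f | Q f) mu01 (observe i s @^-1` [set f]) = mu01 [set th | Q (observe i s th)].
Proof.
have := @measure_preimage_pred R _ (measurableTypeR R) _ (observe i s)
  (measurable_observe i s) lebesgue_measure _ Q (measurable_itv (Interval (BRight 0) (BLeft 1))).
rewrite /mu01 setIC => ->.
rewrite -sum_fine; last by move=> f _; rewrite setIC fin01//; exact: measurable_observe.
by apply: eq_bigr => f _; rewrite setIC.
Qed.

Let sum_weightE (Q : pred outcome) :
  \sum_(o | Q o) weight o = d%:R^-1 * \sum_i \sum_b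
    2^-1 * mu01 [set th | Q (outcome_of i b th)].
Proof.
rewrite big_mkcond.
rewrite (eq_bigr (fun o : outcome => if Q (o.1, o.2) then weight (o.1, o.2) else 0));
  last by case.
rewrite -(pair_bigA _ (fun ib f => if Q (ib, f) then weight (ib, f) else 0))/=.
rewrite (eq_bigr (fun ib : 'I_d * bool =>
   d%:R^-1 * (2^-1 * mu01 [set th | Q (outcome_of ib.1 ib.2 th)]))); last first.
  move=> [i b] _; rewrite -big_mkcond/= /outcome_of/=.
  rewrite -(sum_mu01 i (sign_of R b) (fun f => Q (i, b, f))) !mulr_sumr.
  by apply: eq_bigr => f _; rewrite /weight.
rewrite mulr_sumr.
under [RHS]eq_bigr do rewrite mulr_sumr.
by rewrite (pair_bigA _ (fun i b => d%:R^-1 * (2^-1 * mu01 [set th | Q (outcome_of i b th)]))).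
Qed.

(* It is enough to enclose, for every coordinate and sign, the admissible
   values of theta in an interval. *)
Lemma sum_weight_le (Q : pred outcome) (lo hi : 'I_d -> bool -> R) :
  (forall i b, lo i b <= hi i b) ->
  (forall i b th, 0 < th < 1 -> Q (outcome_of i b th) -> lo i b <= th <= hi i b) ->
  \sum_(o | Q o) weight o <=
  d%:R^-1 * \sum_i (2^-1 * (hi i true - lo i true) + 2^-1 * (hi i false - lo i false)).
Proof.
move=> lohi H; rewrite sum_weightE ler_wpM2l ?invr_ge0//.
apply: ler_sum => i _; rewrite big_bool/=.
have mQ b : measurable [set th | Q (outcome_of i b th)].
  exact: (measurable_preimage_pred (measurable_observe i (sign_of R b)) (fun f => Q (i, b, f))).
have E b : mu01 [set th | Q (outcome_of i b th)] <= hi i b - lo i b.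
  rewrite -lee_fin fineK ?fin01//; apply: lebesgue_le_length => //.
    by apply: measurableI => //; exact: measurable_itv.
  move=> th [/= Qth]; rewrite !in_itv/= => th01.
  exact: H.
by apply: lerD; rewrite ler_wpM2l ?invr_ge0.
Qed.

Lemma sum_weight (d_gt0 : (0 < d)%N) : \sum_o weight o = 1.
Proof.
rewrite sum_weightE.
rewrite (eq_bigr (fun=> 1)).
  by rewrite sumr_const card_ord mulVf// pnatr_eq0 -lt0n.
move=> i _; rewrite big_bool/= /mu01.
have -> : [set th : R | true] = setT by apply/seteqP; split.
rewrite setTI lebesgue_measure_itv/= lte_fin ltr01 -EFinB subr0/=.
lra.
Qed.

(** An outcome is an arbitrary element of a finite type and may come from no [theta] at all. Such
    outcomes have weight zero, so geometric facts are required only of realizable ones. *)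
Lemma ler_weight_sum (f g : outcome -> R) :
  (forall i b th, 0 < th < 1 -> f (outcome_of i b th) <= g (outcome_of i b th)) ->
  \sum_o weight o * f o <= \sum_o weight o * g o.
Proof.
move=> H; apply: ler_sum => -[[i b] e] _.
have [/= E0|/set0P[th [/= <- th01]]] :=
    eqVneq ((observe i (sign_of R b) @^-1` [set e]) `&` `]0, 1[) set0.
  by rewrite /weight/= E0 measure0/= !mulr0 !mul0r.
by rewrite ler_wpM2l ?weight_ge0//; apply: H; move: th01; rewrite in_itv.
Qed.

End Outcome.

(** * The law of the outcome of a round *)

Section RandomOutcome.
Local Open Scope classical_set_scope.
Variables (R : realType) (d k : nat) (c : 'I_k -> 'rV[R]_d) (med : {set 'I_k} -> 'rV[R]_d).
Variables (eps : R) (x : 'rV[R]_d).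
Variables (dO : measure_display) (Omega : measurableType dO) (P : probability Omega R).
Variables (I : nat -> Omega -> 'I_d) (Th : nat -> Omega -> R) (Sg : nat -> Omega -> bool).
Hypothesis mI : forall t a, measurable (I t @^-1` [set a]).
Hypothesis mTh : forall t, measurable_fun setT (Th t).
Hypothesis mSg : forall t b, measurable (Sg t @^-1` [set b]).
Hypothesis indep : forall (n : nat) (A : nat -> {set 'I_d}) (B : nat -> set R) (Cs : nat -> {set bool}),
     (forall t, measurable (B t)) ->
     P (\bigcap_(t in `I_n) [set w | I t w \in A t /\ B t (Th t w) /\ Sg t w \in Cs t])
     = (\prod_(t < n) ((#|A t|%:R / d%:R)%:E
                       * lebesgue_measure (B t `&` `]0%R, 1%R[)
                       * (#|Cs t|%:R / 2)%:E))%E.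

Definition random_outcome (t : nat) (w : Omega) : outcome d k :=
  outcome_of c med eps x (I t w) (Sg t w) (Th t w).

Let random_outcomeE t e : random_outcome t @^-1` [set e] =
  [set w | I t w \in [set e.1.1]%SET /\
     (observe c med eps x e.1.1 (sign_of R e.1.2) @^-1` [set e.2]) (Th t w) /\
     Sg t w \in [set e.1.2]%SET].
Proof.
apply/seteqP; split => w /=; first by move=> <-; rewrite !inE.
by rewrite !inE => -[/eqP iE [oE /eqP sE]]; rewrite /random_outcome /outcome_of iE sE oE; case: e {iE oE sE} => -[].
Qed.

Lemma measurable_random_outcome t e : measurable (random_outcome t @^-1` [set e]).
Proof.
rewrite random_outcomeE.
rewrite (_ : [set w | _] = (I t @^-1` [set e.1.1]) `&`
   (Th t @^-1` (observe c med eps x e.1.1 (sign_of R e.1.2) @^-1` [set e.2])) `&`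
   (Sg t @^-1` [set e.1.2])).
  apply: measurableI => //; apply: measurableI => //.
  by rewrite -[X in measurable X]setTI; apply: mTh => //; exact: measurable_observe.
apply/seteqP; split => w /=; rewrite !inE.
  by move=> [/eqP -> [-> /eqP ->]].
by move=> [[-> ->] ->].
Qed.

Lemma random_outcome_iid (n : nat) (e : nat -> outcome d k) :
  P (\bigcap_(t in `I_n) (random_outcome t @^-1` [set e t])) =
  (\prod_(t < n) weight c med eps x (e t))%:E.
Proof.
under eq_bigcapr do rewrite random_outcomeE.
rewrite (@indep n (fun t => [set (e t).1.1]%SET)
   (fun t => observe c med eps x (e t).1.1 (sign_of R (e t).1.2) @^-1` [set (e t).2])
   (fun t => [set (e t).1.2]%SET));
  last by move=> t; exact: measurable_observe.
rewrite -prodEFin; apply: eq_bigr => t _; rewrite !cards1 /weight.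
rewrite -[X in (_ * X * _)%E]fineK; last first.
  rewrite ge0_fin_numE//; apply: (@le_lt_trans _ _ (lebesgue_measure (`]0, 1[ : set R))).
    apply: le_measure; [apply: mem_set|exact: mem_set|exact: subIsetr].
    by apply: measurableI; [exact: measurable_observe|exact: measurable_itv].
  by rewrite lebesgue_measure_itv/= lte_fin ltr01 -EFinB ltry.
by rewrite -!EFinM; congr EFin; rewrite !mul1r mulrAC mulrA.
Qed.

End RandomOutcome.

(** * Real inequalities *)

Section RealInequalities.
Variable R : realType.

(* [t |-> t `|t|] separates [u <= v] by at least [(v - u)^2 / 2]. *)
Lemma separation_ineq (u v e : R) : 0 <= e <= 1 / 320 -> u <= v ->
  2^-1 * (1 - (Num.max v 0 / (1 + e)) ^+ 2) + 2^-1 * (Num.max (- v) 0 / (1 - e)) ^+ 2 +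
  (2^-1 * (Num.max u 0 / (1 - e)) ^+ 2 + 2^-1 * (1 - (Num.max (- u) 0 / (1 + e)) ^+ 2)) <=
  1 - (v - u) ^+ 2 / 4 + 3 * e / 2 * (u ^+ 2 + v ^+ 2).
Proof.
move=> /andP[e0 e1] uv; rewrite !expr_div_n.
set a := ((1 + e) ^+ 2)^-1; set b := ((1 - e) ^+ 2)^-1.
have aE : a * (1 + e) ^+ 2 = 1 by rewrite mulVf// expf_neq0//; lra.
have bE : b * (1 - e) ^+ 2 = 1 by rewrite mulVf// expf_neq0//; lra.
have a0 : 0 <= a by rewrite invr_ge0 sqr_ge0.
have b0 : 0 <= b by rewrite invr_ge0 sqr_ge0.
have ee : 0 <= e * (1 / 320 - e) by apply: mulr_ge0; lra.
have e2 : 0 <= e * e by rewrite mulr_ge0.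
have e3 : 0 <= e * e * e by rewrite mulr_ge0.
(* Replacing [a] and [b] by these first-order bounds leaves the case [e = 0] plus exactly the error
   term of the statement; what remains is one inequality for each sign pattern of [u] and [v]. *)
have a1 : 1 - 3 * e <= a.
  suff: (1 - 3 * e) * (1 + e) ^+ 2 <= a * (1 + e) ^+ 2 by rewrite ler_pM2r// exprn_gt0//; lra.
  by rewrite aE; lra.
have b1 : b <= 1 + 3 * e.
  suff: b * (1 - e) ^+ 2 <= (1 + 3 * e) * (1 - e) ^+ 2 by rewrite ler_pM2r// exprn_gt0//; lra.
  by rewrite bE; lra.
have au : 0 <= u ^+ 2 * (a - (1 - 3 * e)) by apply: mulr_ge0; [exact: sqr_ge0|lra].
have av : 0 <= v ^+ 2 * (a - (1 - 3 * e)) by apply: mulr_ge0; [exact: sqr_ge0|lra].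
have bu : 0 <= u ^+ 2 * (1 + 3 * e - b) by apply: mulr_ge0; [exact: sqr_ge0|lra].
have bv : 0 <= v ^+ 2 * (1 + 3 * e - b) by apply: mulr_ge0; [exact: sqr_ge0|lra].
have maxE (y : R) : 0 <= y -> Num.max y 0 = y /\ Num.max (- y) 0 = 0.
  by move=> y0; split; [exact: max_l|apply: max_r; rewrite oppr_le0].
have /orP[v0|v0] := le_total 0 v; have /orP[u0|u0] := le_total 0 u; last 3 first.
- have [] := maxE v v0 => -> ->; have [] := maxE (- u); rewrite ?oppr_ge0// opprK => -> ->.
  rewrite expr0n/= sqrrN.
  have : 0 <= (v + u) ^+ 2 by exact: sqr_ge0.
  by lra.
- have -> : v = 0 by lra.
  have -> : u = 0 by lra.
  by rewrite oppr0 maxxx expr0n/=; lra.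
- have [] := maxE (- v); rewrite ?oppr_ge0// opprK => -> ->.
  have [] := maxE (- u); rewrite ?oppr_ge0// opprK => -> ->.
  rewrite expr0n/= !sqrrN.
  have : 0 <= (v - u) * (- u / 2 - 3 * v / 2) by apply: mulr_ge0; lra.
  by lra.
have [] := maxE v v0 => -> ->; have [] := maxE u u0 => -> ->; rewrite expr0n/=.
have : 0 <= (v - u) * (v / 2 + 3 * u / 2) by apply: mulr_ge0; lra.
by lra.
Qed.

Lemma ler_sqrt_sqr (y th : R) : 0 <= th -> Num.sqrt th <= y -> th <= y ^+ 2.
Proof.
move=> th0 H; rewrite -[th in th <= _]sqr_sqrtr//.
by rewrite lerXn2r ?nnegrE ?sqrtr_ge0//; apply: le_trans H; exact: sqrtr_ge0.
Qed.

Lemma ler_sqr_sqrt (y th : R) : 0 <= th -> 0 <= y -> y <= Num.sqrt th -> y ^+ 2 <= th.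
Proof. by move=> th0 y0 H; rewrite -[leRHS]sqr_sqrtr// lerXn2r ?nnegrE ?sqrtr_ge0. Qed.

(** Since [theta] is the square of the scaled cut position, positions in a range of length [L]
    within distance [M] of the median occupy a length at most [2 L M / r^2] of [theta]: the density
    of cuts grows linearly with the distance from the median. *)
Lemma theta_diff (th th' ra L M : R) : 0 < ra -> 0 < th -> th <= th' -> 0 <= L ->
  Num.sqrt th' * ra - Num.sqrt th * ra <= L -> Num.sqrt th' * ra <= M ->
  th' - th <= L * (2 * M) / ra ^+ 2.
Proof.
move=> r0 th0 tt L0 H1 H2; have th'0 : 0 < th' by exact: lt_le_trans tt.
rewrite ler_pdivlMr ?exprn_gt0//.
have -> : (th' - th) * ra ^+ 2 = (Num.sqrt th' * ra - Num.sqrt th * ra) *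
    (Num.sqrt th' * ra + Num.sqrt th * ra).
  rewrite -{1}(sqr_sqrtr (ltW th0)) -{1}(sqr_sqrtr (ltW th'0)); ring.
have s0 : 0 <= Num.sqrt th * ra by rewrite mulr_ge0 ?sqrtr_ge0// ltW.
have ss : Num.sqrt th * ra <= Num.sqrt th' * ra.
  by rewrite ler_pM2r// ler_wsqrtr.
apply: ler_pM => //; lra.
Qed.

(** The tangent at [b ^+ N] of the concave [N]-th root, used to bound the expectation of a root by
    that of the power. It is Bernoulli's inequality for [a / b]. *)
Lemma root_tangent (N : nat) (a b : R) : (0 < N)%N -> 0 <= a -> 0 < b ->
  a <= b * (1 - N%:R^-1) + a ^+ N / b ^+ N.-1 * N%:R^-1.
Proof.
move=> N0 a0 b0.
have bern (t : R) : 0 <= t -> 1 + N%:R * (t - 1) <= t ^+ N.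
  move=> t0; elim: N {N0} => [|N IH]; first by rewrite mul0r addr0 expr0.
  rewrite exprS -natr1; apply: le_trans (ler_wpM2l t0 IH).
  have : 0 <= N%:R * (t - 1) ^+ 2 by rewrite mulr_ge0// sqr_ge0.
  by lra.
case: N N0 bern => // N _ /(_ (a / b)); set t := a / b => bern.
have {bern} : 0 <= t ^+ N.+1 - (1 + N.+1%:R * (t - 1)).
  by rewrite subr_ge0 bern// divr_ge0// ltW.
have aE : a = b * t by rewrite /t mulrC mulfVK// gt_eqF.
have NR : (0 : R) < N.+1%:R by rewrite ltr0n.
have -> : a ^+ N.+1 / b ^+ N.+1.-1 = b * t ^+ N.+1.
  by rewrite aE exprMn /= exprS mulrAC mulfK// expf_neq0// gt_eqF.
rewrite {1}aE; set q := t ^+ _; set n1 := N.+1%:R => H.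
rewrite -subr_ge0.
have -> : b * (1 - n1^-1) + b * q / n1 - b * t = (b / n1) * (q - (1 + n1 * (t - 1))).
  by field; rewrite gt_eqF.
by rewrite mulr_ge0// divr_ge0 ?ltW.
Qed.

(* [savings Q D rho] is the logarithmic potential; it interpolates between
   [D / rho] for small [D] and the constant [ln Q] once [D] exceeds [Q rho]. *)
Definition savings (Q D rho : R) : R := ln (Q * (rho + D) / (Q * rho + D)).

Let denom_gt0 (Q D rho : R) : 1 <= Q -> 0 <= D -> 0 < rho -> 0 < Q * rho + D.
Proof. by move=> Q1 D0 r0; apply: ltr_wpDr => //; apply: mulr_gt0; lra. Qed.

Lemma savings_ge0 (Q D rho : R) : 1 <= Q -> 0 <= D -> 0 < rho -> 0 <= savings Q D rho.
Proof.
move=> Q1 D0 r0; apply: ln_ge0; rewrite ler_pdivlMr ?denom_gt0//.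
have : 0 <= (Q - 1) * D by apply: mulr_ge0; lra.
by lra.
Qed.

Lemma savings_le (Q D rho : R) : 1 <= Q -> 0 <= D -> 0 < rho -> savings Q D rho <= ln Q.
Proof.
move=> Q1 D0 r0; rewrite /savings ler_ln ?posrE//; last by lra.
  rewrite ler_pdivrMr ?denom_gt0// ler_pM2l; last by lra.
  have : 0 <= (Q - 1) * rho by apply: mulr_ge0; lra.
  by lra.
by rewrite divr_gt0// ?denom_gt0// mulr_gt0; lra.
Qed.

Lemma savings_anti (Q D rho rho' : R) : 1 <= Q -> 0 <= D -> 0 < rho -> rho <= rho' ->
  savings Q D rho' <= savings Q D rho.
Proof.
move=> Q1 D0 r0 rr; have r'0 : 0 < rho' by exact: lt_le_trans rr.
have h := denom_gt0 Q1 D0 r0; have h' := denom_gt0 Q1 D0 r'0.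
rewrite /savings ler_ln ?posrE ?divr_gt0//; try by apply: mulr_gt0; lra.
rewrite ler_pdivrMr// mulrAC ler_pdivlMr//.
have : 0 <= Q * ((Q - 1) * D * (rho' - rho)) by rewrite !mulr_ge0//; lra.
by lra.
Qed.

(** Concavity in [D], from [ln y <= y - 1] for the ratio of the two arguments. This leaves
    [Q * rho + D'] in the denominator; replacing [D'] there by [D] goes in the right direction
    whatever the sign of [D' - D]. *)
Lemma savings_tangent (Q D D' rho : R) : 1 <= Q -> 0 <= D -> 0 <= D' -> 0 < rho ->
  savings Q D' rho <= savings Q D rho +
    (D' - D) * ((Q - 1) * rho / ((rho + D) * (Q * rho + D))).
Proof.
move=> Q1 D0 D'0 r0.
have h := denom_gt0 Q1 D0 r0; have h' := denom_gt0 Q1 D'0 r0.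
have rD : 0 < rho + D by lra.
have rD' : 0 < rho + D' by lra.
have Q0 : 0 < Q by lra.
set A := Q * (rho + D') / (Q * rho + D'); set B := Q * (rho + D) / (Q * rho + D).
have A0 : 0 < A by rewrite divr_gt0// mulr_gt0.
have B0 : 0 < B by rewrite divr_gt0// mulr_gt0.
rewrite -lerBlDl /savings -/A -/B -ln_div ?posrE//.
have AB0 : 0 < A / B by rewrite divr_gt0.
apply: le_trans (_ : A / B - 1 <= _).
  by have := @le_ln1Dx R (A / B - 1); rewrite addrCA subrr addr0; apply; lra.
have -> : A / B - 1 = (D' - D) * ((Q - 1) * rho / ((rho + D) * (Q * rho + D'))).
  by rewrite /A /B; field; rewrite !gt_eqF.
have [DD|/ltW DD] := lerP D' D.
  rewrite ler_wnM2l//; first by lra.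
  rewrite ler_wpM2l//; first by rewrite mulr_ge0; lra.
  by rewrite lef_pV2 ?posrE ?mulr_gt0// ler_pM2l//; lra.
rewrite ler_wpM2l//; first by lra.
rewrite ler_wpM2l//; first by rewrite mulr_ge0; lra.
by rewrite lef_pV2 ?posrE ?mulr_gt0// ler_pM2l//; lra.
Qed.

End RealInequalities.

(** * Medians, radii and power sums *)

Section SquaredDistance.
Variables (R : realType) (d : nat).
Implicit Types x y z : 'rV[R]_d.

Lemma sqdist_ge0 x y : 0 <= sqdist x y.
Proof. by apply: sumr_ge0 => i _; exact: sqr_ge0. Qed.

Lemma sqdistC x y : sqdist x y = sqdist y x.
Proof. by apply: eq_bigr => i _; rewrite -sqrrN opprB. Qed.

Lemma sqdist_le2 x y z : sqdist x z <= 2 * sqdist x y + 2 * sqdist y z.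
Proof.
rewrite /sqdist !mulr_sumr -big_split/=; apply: ler_sum => i _.
have : 0 <= (x ord0 i - y ord0 i - (y ord0 i - z ord0 i)) ^+ 2 by exact: sqr_ge0.
by lra.
Qed.

Lemma sqdist_eq0 x y : (sqdist x y == 0) = (x == y).
Proof.
rewrite psumr_eq0; last by move=> i _; exact: sqr_ge0.
apply/allP/eqP => [H|-> i _]; last by rewrite /= subrr expr0n eqxx.
apply/rowP => i; have := H i (mem_index_enum i).
by rewrite /= sqrf_eq0 subr_eq0 => /eqP.
Qed.

Lemma dist2_ge0 x y : 0 <= dist2 x y. Proof. exact: sqrtr_ge0. Qed.

Lemma dist2X x y : dist2 x y ^+ 2 = sqdist x y.
Proof. by rewrite sqr_sqrtr// sqdist_ge0. Qed.

Lemma coord_sqr_le x y i : (x ord0 i - y ord0 i) ^+ 2 <= sqdist x y.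
Proof.
rewrite /sqdist (bigD1 i)//= lerDl; apply: sumr_ge0 => j _; exact: sqr_ge0.
Qed.

Lemma coord_le_dist2 x y i : `|x ord0 i - y ord0 i| <= dist2 x y.
Proof. by rewrite -sqrtr_sqr ler_wsqrtr// coord_sqr_le. Qed.

End SquaredDistance.

Section Geometry.
Variables (R : realType) (d k : nat) (c : 'I_k -> 'rV[R]_d) (med : {set 'I_k} -> 'rV[R]_d).
Variable n : nat.
Hypothesis medP : forall S : {set 'I_k}, (0 < #|S|)%N -> is_median c S (med S).
Hypothesis c_inj : injective c.
Hypothesis n_gt0 : (0 < n)%N.
Hypothesis n_large : (8 * k ^ 2 <= 4 ^ n)%N.
Implicit Types A B : {set 'I_k}.

Definition power_sum A : R := \sum_(j in A) \sum_(l in A) sqdist (c j) (c l) ^+ n.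

(* A smooth surrogate of the diameter, within a factor 2 of it. *)
Definition spread A : R := power_sum A `^ (n.*2)%:R^-1.

Lemma power_sum_ge0 A : 0 <= power_sum A.
Proof. by do 2![apply: sumr_ge0 => ? _]; rewrite exprn_ge0// sqdist_ge0. Qed.

Lemma le_power_sum A B : A \subset B -> power_sum A <= power_sum B.
Proof.
move=> AB; have s0 j l : 0 <= sqdist (c j) (c l) ^+ n by rewrite exprn_ge0// sqdist_ge0.
apply: (@le_trans _ _ (\sum_(j in A) \sum_(l in B) sqdist (c j) (c l) ^+ n)).
  apply: ler_sum => j _; rewrite [leRHS](big_setID A)/= (finset.setIidPr AB) lerDl.
  by apply: sumr_ge0.
rewrite /power_sum [leRHS](big_setID A)/= (finset.setIidPr AB) lerDl.
by apply: sumr_ge0 => j _; apply: sumr_ge0.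
Qed.

Lemma spread_ge0 A : 0 <= spread A. Proof. exact: powR_ge0. Qed.

Lemma spreadX A : spread A ^+ n.*2 = power_sum A.
Proof.
rewrite -powR_mulrn ?spread_ge0// -powRrM mulVf ?powRr1 ?power_sum_ge0//.
by rewrite pnatr_eq0 double_eq0 -lt0n.
Qed.

Lemma spreadX2 A : (spread A ^+ 2) ^+ n = power_sum A.
Proof. by rewrite -exprM mul2n spreadX. Qed.

Lemma le_spread A B : A \subset B -> spread A <= spread B.
Proof.
move=> AB; rewrite -(@ler_pXn2r _ n.*2) ?nnegrE ?spread_ge0//; last by rewrite double_gt0.
by rewrite !spreadX le_power_sum.
Qed.

Lemma sqdist_le_spread A j l : j \in A -> l \in A -> sqdist (c j) (c l) <= spread A ^+ 2.
Proof.
move=> jA lA; rewrite -(@ler_pXn2r _ n) ?nnegrE ?sqdist_ge0 ?sqr_ge0// spreadX2.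
rewrite /power_sum (bigD1 j)//= (bigD1 l)//= -addrA lerDl addr_ge0//.
  by apply: sumr_ge0 => ? _; rewrite exprn_ge0// sqdist_ge0.
by do 2![apply: sumr_ge0 => ? _]; rewrite exprn_ge0// sqdist_ge0.
Qed.

Lemma dist2_le_radius A j : j \in A -> dist2 (c j) (med A) <= cell_radius c med A.
Proof.
by move=> jA; exact: (le_bigmax_cond _ (fun j => dist2 (c j) (med A))).
Qed.

Lemma radius_ge0 A : 0 <= cell_radius c med A.
Proof. exact: bigmax_ge_id. Qed.

Lemma sqdist_le_radius A j : j \in A -> sqdist (c j) (med A) <= cell_radius c med A ^+ 2.
Proof.
move=> jA; rewrite -dist2X lerXn2r ?nnegrE ?dist2_ge0 ?radius_ge0//.
exact: dist2_le_radius.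
Qed.

(** Pairs in a cell are at squared distance at most [4 r^2]. There are at most [k^2] of them, and
    [n_large] makes the [2n]-th root of this number at most 2. *)
Lemma spread_le_radius A : spread A <= 4 * cell_radius c med A.
Proof.
have r0 := radius_ge0 A.
rewrite -(@ler_pXn2r _ n.*2) ?nnegrE ?spread_ge0 ?mulr_ge0//; last by rewrite double_gt0.
rewrite spreadX; apply: (@le_trans _ _ (\sum_(j in A) \sum_(l in A) (4 * cell_radius c med A ^+ 2) ^+ n)).
  apply: ler_sum => j jA; apply: ler_sum => l lA.
  apply: lerXn2r; rewrite ?nnegrE ?sqdist_ge0//; first by rewrite mulr_ge0// sqr_ge0.
  have := sqdist_le2 (c j) (med A) (c l).
  have := sqdist_le_radius jA; have := sqdist_le_radius lA; rewrite [sqdist (med A) _]sqdistC.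
  by lra.
rewrite !sumr_const -mulrnA -[leLHS]mulr_natl.
have -> : (4 * cell_radius c med A) ^+ n.*2 = (4 ^ n)%:R * (4 * cell_radius c med A ^+ 2) ^+ n.
  by rewrite -mul2n exprM natrX -exprMn; congr (_ ^+ _); ring.
rewrite ler_wpM2r//; first by rewrite exprn_ge0// mulr_ge0// sqr_ge0.
rewrite ler_nat; apply: leq_trans n_large; rewrite -mulnn.
have : (#|A| <= k)%N by rewrite -[X in (_ <= X)%N]card_ord max_card.
move=> Ak; apply: (@leq_trans (k * k)); first by rewrite leq_mul.
by rewrite leq_pmull.
Qed.

Lemma power_sum_gt0 A : (2 <= #|A|)%N -> 0 < power_sum A.
Proof.
case/card_gt1P => j [l [jA lA jl]].
rewrite /power_sum (bigD1 j)//= (bigD1 l)//= -addrA ltr_pwDl//.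
  rewrite exprn_gt0// lt_def sqdist_ge0 sqdist_eq0 andbT.
  by apply: contra jl => /eqP/c_inj ->.
rewrite addr_ge0//.
  by apply: sumr_ge0 => ? _; rewrite exprn_ge0// sqdist_ge0.
by do 2![apply: sumr_ge0 => ? _]; rewrite exprn_ge0// sqdist_ge0.
Qed.

Lemma power_sum_eq0 A : (#|A| < 2)%N -> power_sum A = 0.
Proof.
rewrite ltnS => /card_le1_eqP A1; rewrite /power_sum big1// => j jA; rewrite big1// => l lA.
have /eqP -> : sqdist (c j) (c l) == 0 by rewrite sqdist_eq0 (A1 j l jA lA).
by rewrite expr0n -[n]prednK.
Qed.

Lemma spread_gt0 A : (2 <= #|A|)%N -> 0 < spread A.
Proof. by move=> A2; rewrite powR_gt0// power_sum_gt0. Qed.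

Lemma radius_gt0 A : (2 <= #|A|)%N -> 0 < cell_radius c med A.
Proof. by move=> A2; have := spread_gt0 A2; have := spread_le_radius A; lra. Qed.

(* At least half of the centers lie beyond the median, so they are at distance
   at least [|c_j - m|] from [c_j] in the given coordinate. *)
Lemma sqdist_median_le A j : j \in A -> sqdist (c j) (med A) <= 2 * spread A ^+ 2.
Proof.
move=> jA; have A0 : (0 < #|A|)%N by apply/card_gt0P; exists j.
have coord i : #|A|%:R * (c j ord0 i - med A ord0 i) ^+ 2 <=
    2 * \sum_(l in A) (c j ord0 i - c l ord0 i) ^+ 2.
  have half (Q : pred 'I_k) : (2 * #|[set l in A | Q l]| <= #|A|)%N ->
      (forall l, l \in A -> ~~ Q l ->
         (c j ord0 i - med A ord0 i) ^+ 2 <= (c j ord0 i - c l ord0 i) ^+ 2) ->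
      #|A|%:R * (c j ord0 i - med A ord0 i) ^+ 2 <=
      2 * \sum_(l in A) (c j ord0 i - c l ord0 i) ^+ 2.
    move=> H1 H2.
    have : #|[set l in A | ~~ Q l]|%:R * (c j ord0 i - med A ord0 i) ^+ 2 <=
           \sum_(l in A) (c j ord0 i - c l ord0 i) ^+ 2.
      rewrite (big_setID [set l | ~~ Q l])/= mulr_natl -sumr_const -[leLHS]addr0.
      apply: lerD; last by apply: sumr_ge0 => l _; exact: sqr_ge0.
      rewrite (_ : A :&: [set l | ~~ Q l] = [set l in A | ~~ Q l]); last first.
        by apply/setP => l; rewrite !inE.
      by apply: ler_sum => l; rewrite inE => /andP[lA nQ]; exact: H2.
    have : (#|A| <= 2 * #|[set l in A | ~~ Q l]|)%N.
      have := cardsID [set l | Q l] A.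
      have -> : A :&: [set l | Q l] = [set l in A | Q l] by apply/setP => l; rewrite !inE.
      have -> : A :\: [set l | Q l] = [set l in A | ~~ Q l].
        by apply/setP => l; rewrite !inE andbC.
      by move: H1; set a := #|_|; set b := #|_|; set e := #|_|; rewrite !mul2n -!addnn; lia.
    rewrite -(ler_nat R) natrM => H3 H4.
    have := ler_wpM2r (sqr_ge0 (c j ord0 i - med A ord0 i)) H3.
    by lra.
  have [Hlt Hgt] := medP A0 i.
  have [cm|mc] := lerP (c j ord0 i) (med A ord0 i).
    apply: (half _ Hlt) => l lA; rewrite -leNgt => ml.
    rewrite -[leLHS]sqrrN -[leRHS]sqrrN !opprB lerXn2r ?nnegrE; lra.
  apply: (half _ Hgt) => l lA; rewrite -leNgt => ml.
  rewrite lerXn2r ?nnegrE; lra.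
have : #|A|%:R * sqdist (c j) (med A) <= 2 * \sum_(l in A) sqdist (c j) (c l).
  rewrite /sqdist exchange_big/= !mulr_sumr.
  by apply: ler_sum => i _; exact: coord.
have H : \sum_(l in A) sqdist (c j) (c l) <= #|A|%:R * spread A ^+ 2.
  by rewrite mulr_natl -sumr_const; apply: ler_sum => l lA; exact: sqdist_le_spread.
move=> H'; rewrite -(@ler_pM2l _ #|A|%:R) ?ltr0n//.
by lra.
Qed.

Lemma radius_le_spread A : cell_radius c med A ^+ 2 <= 2 * spread A ^+ 2.
Proof.
have sE : Num.sqrt (2 * spread A ^+ 2) ^+ 2 = 2 * spread A ^+ 2.
  by rewrite sqr_sqrtr// mulr_ge0// sqr_ge0.
rewrite -sE lerXn2r ?nnegrE ?radius_ge0 ?sqrtr_ge0//.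
apply: bigmax_le; first exact: sqrtr_ge0.
by move=> j jA; rewrite ler_wsqrtr// sqdist_median_le.
Qed.

End Geometry.

(** * Contraction of the power sum *)

Section Contraction.
Variables (R : realType) (d k : nat) (c : 'I_k -> 'rV[R]_d) (med : {set 'I_k} -> 'rV[R]_d).
Variables (eps : R) (x : 'rV[R]_d) (n : nat).
Hypothesis eps_gt0 : 0 < eps.
Hypothesis eps_le : eps <= 1 / 320.
Hypothesis medP : forall S : {set 'I_k}, (0 < #|S|)%N -> is_median c S (med S).
Hypothesis c_inj : injective c.
Hypothesis n_gt0 : (0 < n)%N.
Hypothesis n_large : (8 * k ^ 2 <= 4 ^ n)%N.
Hypothesis d_gt0 : (0 < d)%N.
Implicit Types A B : {set 'I_k}.

Let w := weight c med eps x.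
Let r A := cell_radius c med A.

Lemma in_low i b th A j : (j \in low (outcome_of c med eps x i b th) A) =
  (c j ord0 i <= med A ord0 i + (sign_of R b + eps) * Num.sqrt th * r A).
Proof. by rewrite /low ffunE inE. Qed.

Lemma in_high i b th A j : (j \in high (outcome_of c med eps x i b th) A) =
  (c j ord0 i >= med A ord0 i + (sign_of R b - eps) * Num.sqrt th * r A).
Proof. by rewrite /high ffunE inE. Qed.

Let u A j i := (c j ord0 i - med A ord0 i) / r A.

Let uE A j i : (2 <= #|A|)%N -> c j ord0 i = med A ord0 i + u A j i * r A.
Proof.
move=> A2; rewrite /u mulfVK; first by rewrite addrC subrK.
by rewrite gt_eqF// (radius_gt0 _ c_inj n_gt0 n_large).
Qed.

Let r_gt0 A : (2 <= #|A|)%N -> 0 < r A.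
Proof. by move=> A2; exact: (radius_gt0 _ c_inj n_gt0 n_large). Qed.

Let u_le1 A j i : (2 <= #|A|)%N -> j \in A -> -1 <= u A j i <= 1.
Proof.
move=> A2 jA; have r0 := r_gt0 A2.
rewrite -ler_norml /u normf_div (gtr0_norm r0) ler_pdivrMr// mul1r.
by apply: le_trans (dist2_le_radius c med jA); exact: coord_le_dist2.
Qed.

Let eps01 : 0 < eps < 1. Proof. by rewrite eps_gt0/=; apply: le_lt_trans eps_le _; lra. Qed.

Let in_lowE i b th A j : (2 <= #|A|)%N -> (j \in low (outcome_of c med eps x i b th) A) =
  (u A j i <= (sign_of R b + eps) * Num.sqrt th).
Proof. by move=> A2; rewrite in_low (uE j i A2) lerD2l ler_pM2r// r_gt0. Qed.

Let in_highE i b th A j : (2 <= #|A|)%N -> (j \in high (outcome_of c med eps x i b th) A) =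
  ((sign_of R b - eps) * Num.sqrt th <= u A j i).
Proof. by move=> A2; rewrite in_high (uE j i A2) lerD2l ler_pM2r// r_gt0. Qed.

Let max0_ge0 (y : R) : 0 <= Num.max y 0. Proof. by rewrite le_max lexx orbT. Qed.

Let theta_lo (y e th : R) : 0 <= e -> 0 < th < 1 -> y <= (1 + e) * Num.sqrt th ->
  (Num.max y 0 / (1 + e)) ^+ 2 <= th <= 1.
Proof.
move=> e0 /andP[th0 th1] H; apply/andP; split; last exact: ltW.
apply: ler_sqr_sqrt; [exact: ltW|by rewrite divr_ge0 ?max0_ge0//; lra|].
rewrite ler_pdivrMr; last by lra.
rewrite ge_max; apply/andP; split; first by rewrite mulrC.
by rewrite mulr_ge0 ?sqrtr_ge0//; lra.
Qed.

Let theta_hi (y e th : R) : 0 < e < 1 -> 0 < th < 1 -> (1 - e) * Num.sqrt th <= y ->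
  0 <= th <= (Num.max y 0 / (1 - e)) ^+ 2.
Proof.
move=> e01 /andP[th0 th1] H; apply/andP; split; first exact: ltW.
apply: ler_sqrt_sqr; [exact: ltW|rewrite ler_pdivlMr; last by lra].
by rewrite le_max mulrC H.
Qed.

Let lo_le1 (y e : R) : 0 <= e -> y <= 1 -> (Num.max y 0 / (1 + e)) ^+ 2 <= 1.
Proof.
move=> e0 y1; rewrite -[leRHS](expr1n _ 2%N) lerXn2r ?nnegrE//.
  by rewrite divr_ge0 ?max0_ge0//; lra.
by rewrite ler_pdivrMr; [rewrite mul1r ge_max; apply/andP; split; lra|lra].
Qed.

Let both_low A j l : (2 <= #|A|)%N -> j \in A -> l \in A ->
  \sum_(o | (j \in low o A) && (l \in low o A)) w o <= d%:R^-1 * \sum_i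
    (2^-1 * (1 - (Num.max (Num.max (u A j i) (u A l i)) 0 / (1 + eps)) ^+ 2) +
     2^-1 * ((Num.max (- Num.max (u A j i) (u A l i)) 0 / (1 - eps)) ^+ 2 - 0)).
Proof.
move=> A2 jA lA; pose v i := Num.max (u A j i) (u A l i).
apply: (sum_weight_le
  (lo := fun i b => if b then (Num.max (v i) 0 / (1 + eps)) ^+ 2 else 0)
  (hi := fun i b => if b then 1 else (Num.max (- v i) 0 / (1 - eps)) ^+ 2)).
  move=> i []; last exact: sqr_ge0.
  apply: lo_le1; first exact: ltW.
  by rewrite ge_max; have /andP[_ ->] := u_le1 i A2 jA; have /andP[_ ->] := u_le1 i A2 lA.
move=> i b th th01; rewrite !in_lowE// -ge_max -/(v i) /sign_of; case: b => H.
  by apply: theta_lo => //; exact: ltW.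
by apply: theta_hi => //; move: H => /=; rewrite ?mulrDl ?mulrBl; lra.
Qed.

Let both_high A j l : (2 <= #|A|)%N -> j \in A -> l \in A ->
  \sum_(o | (j \in high o A) && (l \in high o A)) w o <= d%:R^-1 * \sum_i
    (2^-1 * ((Num.max (Num.min (u A j i) (u A l i)) 0 / (1 - eps)) ^+ 2 - 0) +
     2^-1 * (1 - (Num.max (- Num.min (u A j i) (u A l i)) 0 / (1 + eps)) ^+ 2)).
Proof.
move=> A2 jA lA; pose v i := Num.min (u A j i) (u A l i).
apply: (sum_weight_le
  (lo := fun i b => if b then 0 else (Num.max (- v i) 0 / (1 + eps)) ^+ 2)
  (hi := fun i b => if b then (Num.max (v i) 0 / (1 - eps)) ^+ 2 else 1)).
  move=> i []; first exact: sqr_ge0.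
  apply: lo_le1; first exact: ltW.
  have /andP[uj _] := u_le1 i A2 jA; have /andP[ul _] := u_le1 i A2 lA.
  have : -1 <= v i by rewrite le_min uj ul.
  by lra.
move=> i b th th01; rewrite !in_highE// -le_min -/(v i) /sign_of; case: b => H.
  by apply: theta_hi.
by apply: theta_lo => //; [exact: ltW|move: H => /=; lra].
Qed.

(** A pair shared by both children is counted twice. The excess due to sharing is at most
    [3 * eps / d], because the squares of the scaled coordinates of a center sum to at most 1. *)
Let both_sides A j l : (2 <= #|A|)%N -> j \in A -> l \in A ->
  \sum_(o | (j \in low o A) && (l \in low o A)) w o +
  \sum_(o | (j \in high o A) && (l \in high o A)) w o <=
  1 - (sqdist (c j) (c l) / (4 * r A ^+ 2) - 3 * eps) / d%:R.
Proof.
move=> A2 jA lA; apply: le_trans (lerD (both_low A2 jA lA) (both_high A2 jA lA)) _.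
rewrite -mulrDr -big_split/=.
have r0 := r_gt0 A2; have dR : (0 : R) < d%:R by rewrite ltr0n.
pose f i := 1 - (u A j i - u A l i) ^+ 2 / 4 + 3 * eps / 2 * (u A j i ^+ 2 + u A l i ^+ 2).
apply: (@le_trans _ _ (d%:R^-1 * \sum_i f i)).
  rewrite ler_wpM2l ?invr_ge0//; apply: ler_sum => i _; rewrite !subr0.
  have e01 : 0 <= eps <= 1 / 320 by rewrite (ltW eps_gt0) eps_le.
  have /orP[ul|ul] := le_total (u A j i) (u A l i).
    have -> : Num.max (u A j i) (u A l i) = u A l i by exact: max_r.
    have -> : Num.min (u A j i) (u A l i) = u A j i by exact: min_l.
    by apply: le_trans (separation_ineq e01 ul) _; rewrite /f; lra.
  have -> : Num.max (u A j i) (u A l i) = u A j i by exact: max_l.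
  have -> : Num.min (u A j i) (u A l i) = u A l i by exact: min_r.
  by apply: le_trans (separation_ineq e01 ul) _; rewrite /f; lra.
have sumu h : h \in A -> \sum_i u A h i ^+ 2 <= 1.
  move=> hA; under eq_bigr do rewrite expr_div_n.
  rewrite -mulr_suml ler_pdivrMr ?exprn_gt0// mul1r.
  exact: (sqdist_le_radius c med hA).
have sumd : \sum_i (u A j i - u A l i) ^+ 2 = sqdist (c j) (c l) / r A ^+ 2.
  rewrite /sqdist mulr_suml; apply: eq_bigr => i _.
  by rewrite -expr_div_n; congr (_ ^+ 2); rewrite /u; field; rewrite gt_eqF.
have -> : \sum_i f i = d%:R - (sqdist (c j) (c l) / r A ^+ 2) / 4 +
   3 * eps / 2 * (\sum_i u A j i ^+ 2 + \sum_i u A l i ^+ 2).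
  rewrite /f big_split sumrB sumr_const card_ord -mulr_suml sumd; congr (_ - _ + _).
  by rewrite -mulr_sumr big_split.
have H : 3 * eps / 2 * (\sum_i u A j i ^+ 2 + \sum_i u A l i ^+ 2) <= 3 * eps.
  apply: (@le_trans _ _ (3 * eps / 2 * (1 + 1))); last by lra.
  by rewrite ler_wpM2l//; [have := eps_gt0; lra|apply: lerD; exact: sumu].
set q := sqdist _ _.
have -> : q / (4 * r A ^+ 2) = q / r A ^+ 2 / 4 by field; rewrite gt_eqF.
rewrite mulrC ler_pdivrMr// mulrBl mul1r mulfVK ?gt_eqF//.
by lra.
Qed.

Let power_sumI A J : power_sum c n (A :&: J) =
  \sum_(j in A) \sum_(l in A) ((j \in J) && (l \in J))%:R * sqdist (c j) (c l) ^+ n.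
Proof.
rewrite /power_sum big_mkcond [RHS]big_mkcond/=; apply: eq_bigr => j _.
rewrite inE; case: (j \in A) => //=; case: (j \in J) => /=; last first.
  by rewrite big1// => l _; rewrite mul0r.
rewrite big_mkcond [RHS]big_mkcond/=; apply: eq_bigr => l _.
by rewrite inE; case: (l \in A) => //=; case: (l \in J); rewrite ?mul1r ?mul0r.
Qed.

(** Both children are counted, so the estimate serves the leaf containing [x] as well as the total
    over all leaves. *)
Lemma power_sum_contraction A : (2 <= #|A|)%N ->
  \sum_o w o * (power_sum c n (A :&: low o A) + power_sum c n (A :&: high o A)) <=
  (1 - (64 * d%:R)^-1) * power_sum c n A.
Proof.
move=> A2; have r0 := r_gt0 A2; have dR : (0 : R) < d%:R by rewrite ltr0n.
pose q j l := sqdist (c j) (c l).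
have q0 j l : 0 <= q j l by exact: sqdist_ge0.
pose D2 := spread c n A ^+ 2; pose S := power_sum c n A.
have D0 : 0 < D2 by rewrite exprn_gt0// spread_gt0.
have S0 : 0 < S by exact: power_sum_gt0.
apply: (@le_trans _ _ (\sum_(j in A) \sum_(l in A)
    q j l ^+ n * (1 - (q j l / (4 * r A ^+ 2) - 3 * eps) / d%:R))).
  under eq_bigr => o _.
    rewrite !power_sumI -big_split/= mulr_sumr.
    under eq_bigr => j _ do rewrite -big_split/= mulr_sumr.
    over.
  rewrite exchange_big/=; apply: ler_sum => j jA.
  rewrite exchange_big/=; apply: ler_sum => l lA.
  apply: le_trans (ler_wpM2l _ (both_sides A2 jA lA)); last by rewrite exprn_ge0.
  rewrite mulrDr !mulr_sumr (big_mkcond (fun o => (j \in low o A) && _)).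
  rewrite (big_mkcond (fun o => (j \in high o A) && _)) -big_split/=.
  apply: ler_sum => o _; rewrite -/(q j l).
  by do 2!case: ifP => _; rewrite ?mul1r ?mul0r ?addr0 ?add0r; lra.
(* Pairs with [q j l >= D2 / 4] are separated at rate at least [1 / 32] over [d], since
   [r A ^+ 2 <= 2 * D2]. For shorter pairs the missing decrease is at most the additive term. *)
have pair j l : j \in A -> l \in A ->
  q j l ^+ n * (1 - (q j l / (4 * r A ^+ 2) - 3 * eps) / d%:R) <=
  q j l ^+ n * (1 - (1 / 32 - 3 * eps) / d%:R) + (D2 / 4) ^+ n * (32 * d%:R)^-1.
  move=> jA lA; set t := q j l.
  have rD : r A ^+ 2 <= 2 * D2 by exact: (radius_le_spread medP n_gt0 n_large).
  have tr : t / (8 * D2) <= t / (4 * r A ^+ 2).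
    have p1 : 0 < 4 * r A ^+ 2 by rewrite mulr_gt0// exprn_gt0.
    have p2 : 0 < 8 * D2 by rewrite mulr_gt0.
    by rewrite ler_wpM2l ?q0// lef_pV2//; lra.
  have key : t ^+ n / 32 - (D2 / 4) ^+ n / 32 <= t ^+ n * (t / (8 * D2)).
    have E : t / (8 * D2) = (t / D2) / 8 by field; rewrite gt_eqF.
    have [H|H] := lerP (1 / 4) (t / D2).
      have : 0 <= t ^+ n * (t / D2 - 1 / 4) by rewrite mulr_ge0 ?exprn_ge0 ?q0//; lra.
      have : 0 <= (D2 / 4) ^+ n by rewrite exprn_ge0//; lra.
      by rewrite E; lra.
    have : t ^+ n <= (D2 / 4) ^+ n.
      apply: lerXn2r; rewrite ?nnegrE ?q0//; first by lra.
      move: H; rewrite ltr_pdivrMr//; lra.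
    have : 0 <= t ^+ n * (t / (8 * D2)).
      by rewrite mulr_ge0 ?exprn_ge0 ?q0// divr_ge0 ?q0//; lra.
    by lra.
  have := ler_wpM2l (exprn_ge0 n (q0 j l)) tr; rewrite -/t => tr'.
  rewrite -subr_ge0; set a := t / _; set y := t ^+ n; set z := (D2 / 4) ^+ n.
  have -> : y * (1 - (1 / 32 - 3 * eps) / d%:R) + z * (32 * d%:R)^-1 -
      y * (1 - (a - 3 * eps) / d%:R) = (y * a - (y / 32 - z / 32)) / d%:R.
    by field; rewrite gt_eqF.
  by apply: divr_ge0; [rewrite subr_ge0; exact: le_trans key tr'|exact: ltW].
apply: (@le_trans _ _ (\sum_(j in A) \sum_(l in A)
    (q j l ^+ n * (1 - (1 / 32 - 3 * eps) / d%:R) + (D2 / 4) ^+ n * (32 * d%:R)^-1))).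
  by apply: ler_sum => j jA; apply: ler_sum => l lA; exact: pair.
under eq_bigr do rewrite big_split/= -mulr_suml sumr_const.
rewrite big_split/= -mulr_suml -/(power_sum c n A) -/S sumr_const -mulrnA.
(* [D2 ^+ n] is [S] itself, and [n_large] bounds the number of pairs by [4 ^ n / 8], so the additive
   terms cost only an eighth. *)
have : ((D2 / 4) ^+ n * (32 * d%:R)^-1) *+ (#|A| * #|A|) <= S / 8 * (32 * d%:R)^-1.
  rewrite -mulrnAl ler_wpM2r ?invr_ge0 ?mulr_ge0//.
  rewrite expr_div_n /D2 spreadX2// -/S -[leLHS]mulr_natl.
  have k2 : ((#|A| * #|A|)%:R * 8 : R) <= 4 ^+ n.
    rewrite -natrX -natrM ler_nat; apply: leq_trans n_large; rewrite mulnC leq_mul2l/= -mulnn.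
    by apply: leq_mul; rewrite -[X in (_ <= X)%N]card_ord max_card.
  rewrite mulrA ler_pdivrMr ?exprn_gt0//.
  have := ler_wpM2l (ltW S0) k2; lra.
move=> H; apply: le_trans (lerD (lexx _) H) _.
(* The margin [1/32 - 1/256 - 1/64 = 3/256] must exceed the loss [3 * eps] due to sharing. *)
have e' : 3 * eps <= 3 / 320 by have := eps_le; lra.
rewrite -subr_ge0.
have -> : (1 - (64 * d%:R)^-1) * S -
    (S * (1 - (1 / 32 - 3 * eps) / d%:R) + S / 8 * (32 * d%:R)^-1) =
    S * ((1 / 32 - 1 / 256 - 1 / 64) - 3 * eps) / d%:R.
  by field; rewrite gt_eqF.
by apply: divr_ge0; [apply: mulr_ge0; [exact: ltW|lra]|exact: ltW].
Qed.

End Contraction.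

(** * Transitions and loss of a center *)

Section Transition.
Variables (R : realType) (d k : nat) (c : 'I_k -> 'rV[R]_d) (med : {set 'I_k} -> 'rV[R]_d).
Variables (eps : R) (x : 'rV[R]_d) (n : nat).
Hypothesis eps_gt0 : 0 < eps.
Hypothesis eps_le : eps <= 1 / 320.
Hypothesis medP : forall S : {set 'I_k}, (0 < #|S|)%N -> is_median c S (med S).
Hypothesis c_inj : injective c.
Hypothesis n_gt0 : (0 < n)%N.
Hypothesis n_large : (8 * k ^ 2 <= 4 ^ n)%N.
Hypothesis d_gt0 : (0 < d)%N.
Implicit Types A B J : {set 'I_k}.

Let w := weight c med eps x.
Let r A := cell_radius c med A.
Let out := outcome_of c med eps x.
Let rho j := dist2 x (c j).

Let sum_w : \sum_o w o = 1. Proof. exact: sum_weight. Qed.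

Lemma low_or_high i b th A j : 0 <= th ->
  (j \in low (out i b th) A) || (j \in high (out i b th) A).
Proof.
move=> th0; rewrite in_low in_high; set T := Num.sqrt th * cell_radius c med A.
have T0 : 0 <= eps * T by rewrite !mulr_ge0 ?sqrtr_ge0 ?cell_radius_ge0 ?radius_ge0// ltW.
by rewrite -!mulrA -/T; have [//|H] := lerP; rewrite /=; lra.
Qed.

Lemma next_set_sub A (o : outcome d k) : next_set A o \subset A.
Proof. by rewrite /next_set; case: ifP => // _; exact: subsetIl. Qed.

Lemma next_set_neq0 A (o : outcome d k) : A != finset.set0 -> next_set A o != finset.set0.
Proof.
by move=> A0; rewrite /next_set; case: ifP => // /and3P[_ L H]; rewrite /xside; case: ifP.
Qed.

Lemma next_set_small A (o : outcome d k) : (#|A| < 2)%N -> next_set A o = A.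
Proof. by rewrite /next_set /splits; case: leqP. Qed.

(** As every center is low or high, an empty side forces the other one to contain all of [A]. *)
Lemma power_sum_children A i b th : 0 <= th ->
  ~~ [&& A :&: low (out i b th) A != finset.set0 & A :&: high (out i b th) A != finset.set0] ->
  power_sum c n A <=
    power_sum c n (A :&: low (out i b th) A) + power_sum c n (A :&: high (out i b th) A).
Proof.
move=> th0; have lh j := low_or_high i b A j th0.
rewrite negb_and !negbK => /orP[/eqP E|/eqP E]; rewrite E.
  rewrite -[leLHS]add0r lerD ?power_sum_ge0//; apply: le_power_sum.
  apply/fintype.subsetP => j jA; rewrite inE jA/=; case/orP: (lh j) => // jl.
  by have : j \in A :&: low (out i b th) A by [rewrite inE jA]; rewrite E inE.
rewrite -[leLHS]addr0 lerD ?power_sum_ge0//; apply: le_power_sum.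
apply/fintype.subsetP => j jA; rewrite inE jA/=; case/orP: (lh j) => // jl.
by have : j \in A :&: high (out i b th) A by [rewrite inE jA]; rewrite E inE.
Qed.

Let power_sum_next A i b th : (2 <= #|A|)%N -> 0 <= th ->
  power_sum c n (next_set A (out i b th)) <=
    power_sum c n (A :&: low (out i b th) A) + power_sum c n (A :&: high (out i b th) A).
Proof.
move=> A2 th0; rewrite /next_set /splits A2/=.
case: ifPn => [_|]; last exact: power_sum_children.
by rewrite /xside; case: ifP => _; rewrite ?lerDl ?lerDr power_sum_ge0.
Qed.

(** The rate [1 / (64 d)] of the power sum divided by the exponent [2n], as befits its [2n]-th
    root. *)
Definition rate : R := (64 * d%:R * n.*2%:R)^-1.

Lemma spread_small A : (#|A| < 2)%N -> spread c n A = 0.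
Proof.
move=> A2; apply/eqP; have : spread c n A ^+ n.*2 == 0 by rewrite spreadX// power_sum_eq0.
by rewrite expf_eq0 double_gt0 n_gt0.
Qed.

Lemma spread_contraction A :
  \sum_o w o * spread c n (next_set A o) <= (1 - rate) * spread c n A.
Proof.
have [A2|A2] := leqP 2 #|A|; last first.
  rewrite spread_small// mulr0 big1// => o _.
  by rewrite next_set_small// spread_small// mulr0.
set D := spread c n A; have D0 : 0 < D by exact: spread_gt0.
have N0 : (0 < n.*2)%N by rewrite double_gt0.
pose a := D * (1 - (n.*2)%:R^-1); pose b := (D ^+ n.*2.-1)^-1 * (n.*2)%:R^-1.
have b0 : 0 <= b by rewrite mulr_ge0// invr_ge0 exprn_ge0// ltW.
apply: (@le_trans _ _ (\sum_o w o * (a + b *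
    (power_sum c n (A :&: low o A) + power_sum c n (A :&: high o A))))).
  apply: ler_weight_sum => i e th /andP[th0 _]; set o := outcome_of _ _ _ _ _ _ _.
  have := root_tangent N0 (spread_ge0 c n (next_set A o)) D0.
  rewrite spreadX// => /le_trans; apply.
  rewrite lerD2l -mulrA mulrC ler_wpM2l//.
  by apply: power_sum_next => //; exact: ltW.
rewrite (eq_bigr (fun o => w o * a + b * (w o * (power_sum c n (A :&: low o A) +
   power_sum c n (A :&: high o A))))); last first.
  by move=> o _; rewrite mulrDr (mulrCA (w o) b).
rewrite big_split/=.
have -> : \sum_o w o * a = a by rewrite -[RHS]mul1r -sum_w mulr_suml.
rewrite -[X in _ + X]mulr_sumr.
apply: le_trans (lerD (lexx a) (ler_wpM2l b0
  (power_sum_contraction x eps_gt0 eps_le medP c_inj n_gt0 n_large d_gt0 A2))) _.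
have NR : (0 : R) < (n.*2)%:R by rewrite ltr0n.
have dR : (0 : R) < d%:R by rewrite ltr0n.
have DN : D ^+ n.*2 = D * D ^+ n.*2.-1 by rewrite -exprS prednK.
have P0 : 0 < D ^+ n.*2.-1 by rewrite exprn_gt0.
rewrite -spreadX// -/D DN /b /a /rate; move: P0 NR dR.
set P := D ^+ _; set N := n.*2%:R; set dd := d%:R => P0 NR dR.
rewrite le_eqVlt; apply/orP; left; apply/eqP; field.
by rewrite !gt_eqF.
Qed.

(** Only two admissible values of [theta] have to be compared, with no explicit endpoints: the
    infimum of the admissible values serves as left end of the enclosing interval. *)
Lemma sum_weight_diam (Q : pred (outcome d k)) (L : 'I_d -> R) : (forall i, 0 <= L i) ->
  (forall i b th th', 0 < th < 1 -> 0 < th' < 1 -> th <= th' ->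
     Q (out i b th) -> Q (out i b th') -> th' - th <= L i) ->
  \sum_(o | Q o) w o <= d%:R^-1 * \sum_i L i.
Proof.
move=> L0 H; pose E i b := [set th | 0 < th < 1 /\ Q (out i b th)]%classic.
apply: le_trans (@sum_weight_le _ _ _ c med eps x Q (fun i b => inf (E i b))
   (fun i b => inf (E i b) + L i) _ _) _.
- by move=> i b; rewrite lerDl.
- move=> i b th th01 Qth; apply/andP; split.
    by apply: ge_inf => //; exists 0 => t [/andP[/ltW]].
  rewrite -lerBlDr; apply: lb_le_inf; first by exists th.
  move=> t [t01 Qt]; have [tth|/ltW tth] := lerP t th; last by have := L0 i; lra.
  by have := H i b t th t01 th01 tth Qt Qth; lra.
rewrite ler_wpM2l ?invr_ge0//; apply: ler_sum => i _.
by rewrite ![_ + L i]addrC !addrK; lra.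
Qed.

(** The center is missed only if it lies beyond the cut by more than the sharing margin [eps * T],
    on the side away from [x]. The shifted position [m + (s + eps) T] or [m + (s - eps) T] then lies
    between [x] and [c j] and determines the kept side. *)
Lemma lostP A j i b th : j \in A -> j \notin next_set A (out i b th) ->
  [/\ splits (out i b th) A, next_set A (out i b th) = A :&: xside (out i b th) A &
  let T := Num.sqrt th * r A in let m := med A ord0 i in let s := sign_of R b in
  (x ord0 i <= m + s * T /\ m + (s + eps) * T < c j ord0 i /\
     xside (out i b th) A = low_centers c med eps A i s th) \/
  (c j ord0 i < m + (s - eps) * T /\ m + s * T < x ord0 i /\
     xside (out i b th) A = high_centers c med eps A i s th)].
Proof.
move=> jA; rewrite /next_set; case: ifP => [sp|]; last by rewrite jA.
have lE : low (out i b th) A = low_centers c med eps A i (sign_of R b) th by rewrite /low ffunE.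
have hE : high (out i b th) A = high_centers c med eps A i (sign_of R b) th.
  by rewrite /high ffunE.
have bE : ((out i b th).2 A).2 = below_cut c med x A i (sign_of R b) th by rewrite ffunE.
rewrite inE jA/= => jx; split => //=; move: jx.
rewrite /xside lE hE bE; case: ifPn; rewrite /below_cut -?ltNge => H; rewrite inE -ltNge => jx;
  [left|right]; by rewrite -!mulrA in H, jx; split.
Qed.

(** In coordinate [i] the cut falls between [x] and [c j], a range of length [a i] within
    [a i + b i] of the median; [theta_diff] applies, and the products [a i * b i] are summed by
    Cauchy-Schwarz. *)
Lemma loss_le A j : (2 <= #|A|)%N -> j \in A ->
  \sum_(o | j \notin next_set A o) w o <=
  d%:R^-1 * (2 * (rho j * r A + rho j ^+ 2) / r A ^+ 2).
Proof.
move=> A2 jA; have r0 : 0 < r A by exact: (radius_gt0 _ c_inj n_gt0 n_large).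
pose a i := `|x ord0 i - c j ord0 i|; pose b i := `|c j ord0 i - med A ord0 i|.
have sa : \sum_i a i ^+ 2 = rho j ^+ 2.
  by rewrite dist2X; apply: eq_bigr => i _; rewrite real_normK ?num_real.
have sb : \sum_i b i ^+ 2 <= r A ^+ 2.
  apply: le_trans (sqdist_le_radius c med jA).
  by apply: ler_sum => i _; rewrite real_normK ?num_real.
have a0 i : 0 <= a i by exact: normr_ge0.
have b0 i : 0 <= b i by exact: normr_ge0.
have rho0 : 0 <= rho j by exact: dist2_ge0.
apply: le_trans (@sum_weight_diam _ (fun i => a i * (2 * (a i + b i)) / r A ^+ 2) _ _) _.
- by move=> i; rewrite divr_ge0 ?sqr_ge0// !mulr_ge0// addr_ge0.
- move=> i s th th' /andP[th0 _] /andP[th'0 _] tt l1 l2.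
  have [_ _ /=] := lostP jA l1; have [_ _ /=] := lostP jA l2.
  set T := Num.sqrt th * r A; set T' := Num.sqrt th' * r A.
  have T0 : 0 <= T by rewrite mulr_ge0 ?sqrtr_ge0// ltW.
  have T'0 : 0 <= T' by rewrite mulr_ge0 ?sqrtr_ge0// ltW.
  have eT : 0 <= eps * T by rewrite mulr_ge0// ltW.
  have eT' : 0 <= eps * T' by rewrite mulr_ge0// ltW.
  have na := ler_norm (x ord0 i - c j ord0 i); have nb := ler_norm (c j ord0 i - med A ord0 i).
  have na' := ler_norm (c j ord0 i - x ord0 i); have nb' := ler_norm (med A ord0 i - c j ord0 i).
  rewrite distrC -/(a i) in na'; rewrite distrC -/(b i) in nb'.
  rewrite -/(a i) in na; rewrite -/(b i) in nb.
  move=> H1 H2; apply: theta_diff => //; rewrite -/T -/T'; move: H1 H2; rewrite /sign_of.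
    by case: s {l1 l2} => -[[? []]|[? []]] ? _ [[? []]|[? []]] ? _; lra.
  by case: s {l1 l2} => -[[? []]|[? []]] ? _ _; lra.
rewrite ler_wpM2l ?invr_ge0// -mulr_suml ler_wpM2r ?invr_ge0 ?sqr_ge0//.
have ab : \sum_i a i * b i <= rho j * r A.
  have [E|rho1] := eqVneq (rho j) 0.
    rewrite E mul0r big1// => i _; have : \sum_i a i ^+ 2 = 0 by rewrite sa E expr0n.
    move/psumr_eq0P => H; have /eqP := H (fun i _ => sqr_ge0 _) i isT.
    by rewrite sqrf_eq0 => /eqP ->; rewrite mul0r.
  have rho2 : 0 < rho j by rewrite lt_def rho1.
  (* Cauchy-Schwarz as a weighted arithmetic-geometric inequality, with weights balanced by [rho j]
     and [r A]. *)
  apply: (@le_trans _ _ (\sum_i ((r A / rho j / 2) * a i ^+ 2 + (rho j / r A / 2) * b i ^+ 2))).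
    apply: ler_sum => i _; rewrite -subr_ge0.
    have -> : r A / rho j / 2 * a i ^+ 2 + rho j / r A / 2 * b i ^+ 2 - a i * b i =
        (r A * a i - rho j * b i) ^+ 2 / (2 * rho j * r A).
      by field; rewrite !gt_eqF.
    by rewrite divr_ge0 ?sqr_ge0// !mulr_ge0// ltW.
  rewrite big_split/= -!mulr_sumr sa.
  have := ler_wpM2l (_ : 0 <= rho j / r A / 2) sb => H.
  apply: le_trans (lerD (lexx _) (H _)) _; first by rewrite !divr_ge0// ltW.
  rewrite le_eqVlt; apply/orP; left; apply/eqP; field.
  by rewrite !gt_eqF.
have -> : \sum_i a i * (2 * (a i + b i)) = 2 * (\sum_i a i * b i + \sum_i a i ^+ 2).
  by rewrite -big_split/= mulr_sumr; apply: eq_bigr => i _; ring.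
rewrite sa; lra.
Qed.

End Transition.

(** * The crude potential *)

Section CrudePotential.
Variables (R : realType) (d k : nat) (c : 'I_k -> 'rV[R]_d) (med : {set 'I_k} -> 'rV[R]_d).
Variables (eps : R) (x : 'rV[R]_d) (n : nat).
Hypothesis eps_gt0 : 0 < eps.
Hypothesis eps_le : eps <= 1 / 320.
Hypothesis medP : forall S : {set 'I_k}, (0 < #|S|)%N -> is_median c S (med S).
Hypothesis c_inj : injective c.
Hypothesis n_gt0 : (0 < n)%N.
Hypothesis n_large : (8 * k ^ 2 <= 4 ^ n)%N.
Hypothesis d_gt0 : (0 < d)%N.
Implicit Types A B J : {set 'I_k}.

Let w := weight c med eps x.
Let r A := cell_radius c med A.
Let rho j := dist2 x (c j).

Let w0 o : 0 <= w o. Proof. exact: weight_ge0. Qed.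
Let sum_w : \sum_o w o = 1. Proof. exact: sum_weight. Qed.

Definition far A : R := \big[Num.max/0]_(j in A) sqdist x (c j).

(** Chosen so that [crude_factor * rate = 160 / d]. Here [160 = 10 * 4 * 4]: the constant of the
    loss probability, the bound [4 * D ^+ 2] on the cost, and [D <= 4 * r A]. *)
Definition crude_factor : R := 160 * 64 * n.*2%:R.

Definition crude_bound A j : R :=
  4 * sqdist x (c j) + crude_factor * dist2 x (c j) * spread c n A.

(* Superharmonic bound on the expected final cost from the set [A]. *)
Definition crude A : R := \big[Num.min/far A]_(j in A) crude_bound A j.

Lemma crude_factor_ge0 : 0 <= crude_factor. Proof. by rewrite !mulr_ge0. Qed.

Lemma le_far A B : A \subset B -> far A <= far B.
Proof.
move=> /fintype.subsetP AB; apply: bigmax_le; first exact: bigmax_ge_id.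
by move=> j jA; apply: (le_bigmax_cond _ (fun j => sqdist x (c j))); exact: AB.
Qed.

Lemma far_ge0 A : 0 <= far A. Proof. exact: bigmax_ge_id. Qed.

Lemma far_le_spread A j : j \in A -> far A <= 2 * sqdist x (c j) + 2 * spread c n A ^+ 2.
Proof.
move=> jA; apply: bigmax_le.
  by rewrite addr_ge0// mulr_ge0// ?sqdist_ge0 ?sqr_ge0.
move=> l lA; apply: le_trans (sqdist_le2 x (c j) (c l)) _.
by rewrite lerD2l ler_wpM2l// sqdist_le_spread.
Qed.

Lemma crude_bound_ge0 A j : 0 <= crude_bound A j.
Proof.
by rewrite addr_ge0// !mulr_ge0// ?crude_factor_ge0 ?sqdist_ge0 ?dist2_ge0 ?spread_ge0.
Qed.

Lemma crude_ge0 A : 0 <= crude A.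
Proof. by apply: le_bigmin => [|j _]; [exact: far_ge0|exact: crude_bound_ge0]. Qed.

Lemma crude_le_far A : crude A <= far A. Proof. exact: bigmin_le_id. Qed.

Lemma crude_le_bound A j : j \in A -> crude A <= crude_bound A j.
Proof. by move=> jA; exact: bigmin_le_cond. Qed.

Lemma sqdist_le_crude j : sqdist x (c j) <= crude [set j].
Proof.
apply: le_bigmin => [|l].
  by apply: (le_bigmax_cond _ (fun j => sqdist x (c j))); rewrite inE.
rewrite inE => /eqP ->; rewrite /crude_bound; have := sqdist_ge0 x (c j).
have := spread_ge0 c n [set j]; have := dist2_ge0 x (c j) => q0 s0.
have := mulr_ge0 (mulr_ge0 crude_factor_ge0 q0) s0.
by lra.
Qed.

(** It suffices to stay below each term of the minimum. The term [far] is monotone in the set; for a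
    center [j], the expected decrease of the spread pays for the probability of losing [j] times the
    cost of the loss. *)
Lemma crude_superharmonic A : \sum_o w o * crude (next_set A o) <= crude A.
Proof.
apply: le_bigmin => [|j jA].
  apply: (@le_trans _ _ (\sum_o w o * far A)).
    apply: ler_sum => o _; rewrite ler_wpM2l//.
    by apply: le_trans (crude_le_far _) (le_far (next_set_sub _ _)).
  by rewrite -mulr_suml sum_w mul1r.
pose e := Num.max 0 (far A - 4 * sqdist x (c j)).
have e0 : 0 <= e by rewrite le_max lexx.
pose Kr := crude_factor * rho j.
have Kr0 : 0 <= Kr by rewrite mulr_ge0 ?crude_factor_ge0 ?dist2_ge0.
apply: (@le_trans _ _ (\sum_o w o * (4 * sqdist x (c j) + Kr * spread c n (next_set A o) +
    (j \notin next_set A o)%:R * e))).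
  apply: ler_sum => o _; rewrite ler_wpM2l//.
  have [jN|jN] := boolP (j \in next_set A o); rewrite /=.
    by rewrite mul0r addr0; exact: crude_le_bound.
  rewrite mul1r; apply: le_trans (crude_le_far _) _.
  apply: le_trans (le_far (next_set_sub _ _)) _.
  have : far A - 4 * sqdist x (c j) <= e by rewrite le_max lexx orbT.
  by have := mulr_ge0 Kr0 (spread_ge0 c n (next_set A o)); lra.
have -> : \sum_o w o * (4 * sqdist x (c j) + Kr * spread c n (next_set A o) +
    (j \notin next_set A o)%:R * e) = 4 * sqdist x (c j) +
    Kr * \sum_o w o * spread c n (next_set A o) +
    (\sum_(o | j \notin next_set A o) w o) * e.
  have S4 : 4 * sqdist x (c j) = \sum_o w o * (4 * sqdist x (c j)).
    by rewrite -mulr_suml sum_w mul1r.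
  rewrite [X in _ = X + _ + _]S4 mulr_sumr mulr_suml.
  rewrite [X in _ = _ + X]big_mkcond -!big_split/=; apply: eq_bigr => o _.
  by case: (_ \notin _); rewrite /= ?mul0r ?mul1r; ring.
have lam := spread_contraction x eps_gt0 eps_le medP c_inj n_gt0 n_large d_gt0 A.
have dR : (0 : R) < d%:R by rewrite ltr0n.
set D := spread c n A in lam *.
have D0 : 0 <= D by exact: spread_ge0.
have Krate : crude_factor * rate R d n = 160 / d%:R.
  have NR : (0 : R) < (n.*2)%:R by rewrite ltr0n double_gt0.
  by rewrite /crude_factor /rate; field; rewrite !gt_eqF.
have main : (\sum_(o | j \notin next_set A o) w o) * e <= 160 / d%:R * (rho j * D).
  have RHS0 : 0 <= 160 / d%:R * (rho j * D).
    by rewrite !mulr_ge0 ?dist2_ge0// invr_ge0 ltW.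
  have rX : rho j ^+ 2 = sqdist x (c j) by exact: dist2X.
  have fD := far_le_spread jA; rewrite -rX -/D in fD.
  have rho0 : 0 <= rho j by exact: dist2_ge0.
  (* If [D <= rho j], every center of [A] costs at most [4 * rho j ^+ 2], which the constant term
     already covers; hence its coefficient 4. *)
  have [Dr|rD] := lerP D (rho j).
    have DD : D ^+ 2 <= rho j ^+ 2 by rewrite lerXn2r.
    have -> : e = 0 by apply: max_l; rewrite -rX; lra.
    by rewrite mulr0.
  have A2 : (2 <= #|A|)%N.
    rewrite leqNgt; apply/negP => A2; have := spread_small c n_gt0 A2; rewrite -/D; lra.
  have r0 : 0 < r A by exact: (radius_gt0 _ c_inj n_gt0 n_large).
  have Dr4 : D <= 4 * r A by exact: spread_le_radius.
  have e4 : e <= 4 * D ^+ 2.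
    have DD : rho j ^+ 2 <= D ^+ 2 by rewrite lerXn2r// ltW.
    by rewrite ge_max; apply/andP; split; [rewrite mulr_ge0// sqr_ge0|rewrite -rX; have := sqr_ge0 (rho j); lra].
  have loss := loss_le med x eps_gt0 c_inj n_gt0 n_large A2 jA.
  have loss2 : d%:R^-1 * (2 * (rho j * r A + rho j ^+ 2) / r A ^+ 2) <=
      10 / d%:R * (rho j / r A).
    rewrite -subr_ge0.
    have -> : 10 / d%:R * (rho j / r A) - d%:R^-1 * (2 * (rho j * r A + rho j ^+ 2) / r A ^+ 2) =
       2 * (rho j * (4 * r A - rho j)) / (d%:R * r A ^+ 2) by field; rewrite !gt_eqF.
    by rewrite divr_ge0// ?mulr_ge0// ?sqr_ge0; lra.
  have P0 : 0 <= \sum_(o | j \notin next_set A o) w o by apply: sumr_ge0.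
  apply: le_trans (ler_pM P0 e0 (le_trans loss loss2) e4) _.
  rewrite -subr_ge0.
  have -> : 160 / d%:R * (rho j * D) - 10 / d%:R * (rho j / r A) * (4 * D ^+ 2) =
     40 * (rho j * D * (4 * r A - D)) / (d%:R * r A) by field; rewrite !gt_eqF.
  rewrite divr_ge0// !mulr_ge0//; try exact: ltW.
  by rewrite subr_ge0.
have H := ler_wpM2l Kr0 lam.
have Kl : Kr * (1 - rate R d n) * D = Kr * D - 160 / d%:R * (rho j * D).
  by rewrite -Krate /Kr; ring.
rewrite /crude_bound -/D -/(rho j) -/Kr; lra.
Qed.

End CrudePotential.

(** * The refined potential *)

Section Pieces.
Variables (R : realType) (k : nat) (p : 'I_k -> R) (y z : R).

(* The possible cuts between [y] and [z], classified by the set [J] of points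
   lying on the same side of the cut as [y]. *)
Definition between : set R := if y < z then `[y, z[%classic else `]z, y]%classic.

Definition y_side (t : R) : {set 'I_k} :=
  if y < z then [set j | p j <= t] else [set j | t <= p j].

Definition piece (J : {set 'I_k}) : R :=
  fine (lebesgue_measure (between `&` y_side @^-1` [set J])%classic).

Lemma piece_ge0 J : 0 <= piece J. Proof. by rewrite fine_ge0. Qed.

Let measurable_between : measurable between.
Proof. by rewrite /between; case: ifP => _; exact: measurable_itv. Qed.

Let measurable_y_side J : measurable (y_side @^-1` [set J])%classic.
Proof.
rewrite (_ : _ @^-1` _ = \bigcap_(j in setT) (if (j \in J) == (y < z) then
    (if y < z then `[p j, +oo[ else `]p j, +oo[) else
    (if y < z then `]-oo, p j[ else `]-oo, p j]))%classic)%classic.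
  apply: fin_bigcap_measurable => [|j _]; first exact: finite_finset.
  by case: (_ == _); case: (y < z); exact: measurable_itv.
apply/seteqP; split => t /=.
  move=> <- j _; rewrite /y_side; case: (y < z); rewrite inE.
    by case: (lerP (p j) t) => H /=; rewrite in_itv/= ?andbT.
  by case: (lerP t (p j)) => H /=; rewrite in_itv/= ?andbT.
move=> H; apply/setP => j; have := H j Logic.I; rewrite /y_side.
case: (y < z); rewrite inE.
  case: (j \in J) => /=; rewrite in_itv/= ?andbT => //.
  by rewrite ltNge => /negbTE.
case: (j \in J) => /=; rewrite in_itv/= ?andbT => //.
by rewrite ltNge => /negbTE.
Qed.

Let between_measure : lebesgue_measure between = `|y - z|%:E.
Proof.
rewrite /between; case: ltP => yz; rewrite lebesgue_measure_itv/= lte_fin.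
  by rewrite yz distrC gtr0_norm ?subr_gt0.
case: ltP => zy; first by rewrite gtr0_norm ?subr_gt0.
have -> : y = z by apply/eqP; rewrite eq_le zy yz.
by rewrite subrr normr0.
Qed.

Let fin_piece J : lebesgue_measure (between `&` y_side @^-1` [set J])%classic \is a fin_num.
Proof.
rewrite ge0_fin_numE//; apply: (@le_lt_trans _ _ (lebesgue_measure between)).
  apply: le_measure; [apply: mem_set|exact: mem_set|exact: subIsetl].
  by apply: measurableI => //; exact: measurable_y_side.
by rewrite between_measure ltry.
Qed.

Lemma sum_piece : \sum_J piece J = `|y - z|.
Proof.
have := @measure_preimage_pred R _ (measurableTypeR R) _ y_side
  measurable_y_side lebesgue_measure _ xpredT measurable_between.
rewrite (_ : [set w | _]%classic = setT); last by apply/seteqP; split.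
rewrite setIT => E; apply: EFin_inj; apply: etrans between_measure; apply: etrans (esym E).
rewrite -sumEFin; apply: eq_bigr => J _.
by rewrite fineK.
Qed.

(** [y_side] is monotone in the position, so a class contains the whole segment between two of its
    points. *)
Lemma piece_convex J t t' : t <= t' -> between t -> between t' ->
  y_side t = J -> y_side t' = J -> t' - t <= piece J.
Proof.
move=> tt bt bt' sJ sJ'; rewrite -lee_fin fineK//.
have -> : (t' - t)%:E = lebesgue_measure (`[t, t']%classic : set R).
  rewrite lebesgue_measure_itv/= lte_fin; case: ltP => // t't.
  by have -> : t = t' by [apply/eqP; rewrite eq_le tt t't]; rewrite subrr.
apply: le_measure; [exact: mem_set|apply: mem_set|].
  by apply: measurableI => //; exact: measurable_y_side.
move=> v /=; rewrite in_itv/= => /andP[tv vt']; split.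
  move: bt bt'; rewrite /between; case: ifP => _ /=; rewrite !in_itv/=.
    by move=> /andP[a1 _] /andP[_ a2]; rewrite (le_trans a1 tv) (le_lt_trans vt' a2).
  by move=> /andP[a1 _] /andP[_ a2]; rewrite (lt_le_trans a1 tv) (le_trans vt' a2).
apply/setP => j; move: (sJ) (sJ'); rewrite /y_side; case: ifP => _ E E'.
  rewrite inE; apply/idP/idP => [jv|jJ].
    by rewrite -E' inE; exact: le_trans jv vt'.
  by move: jJ; rewrite -E inE => /le_trans; apply.
rewrite inE; apply/idP/idP => [jv|jJ].
  by rewrite -E inE; exact: le_trans tv jv.
by move: jJ; rewrite -E' inE; exact: le_trans.
Qed.

End Pieces.

(** * Losing the nearest center through one piece *)

Section FinePotential.
Variables (R : realType) (d k : nat) (c : 'I_k -> 'rV[R]_d) (med : {set 'I_k} -> 'rV[R]_d).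
Variables (eps : R) (x : 'rV[R]_d) (n : nat) (js : 'I_k).
Hypothesis eps_gt0 : 0 < eps.
Hypothesis eps_le : eps <= 1 / 320.
Hypothesis medP : forall S : {set 'I_k}, (0 < #|S|)%N -> is_median c S (med S).
Hypothesis c_inj : injective c.
Hypothesis n_gt0 : (0 < n)%N.
Hypothesis n_large : (8 * k ^ 2 <= 4 ^ n)%N.
Hypothesis d_gt0 : (0 < d)%N.
Hypothesis js_nearest : forall j, sqdist x (c js) <= sqdist x (c j).
Implicit Types A B J : {set 'I_k}.

Let w := weight c med eps x.
Let out := outcome_of c med eps x.
Let r A := cell_radius c med A.
Let rho j := dist2 x (c j).
Let a i := `|x ord0 i - c js ord0 i|.
Let pc i J := piece (fun j => c j ord0 i) (x ord0 i) (c js ord0 i) J.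

Let w0 o : 0 <= w o. Proof. exact: weight_ge0. Qed.
Let sum_w : \sum_o w o = 1. Proof. exact: sum_weight. Qed.

(* Both effective cut positions lie in the same piece, and the lack of sharing
   forces [eps sqrt(theta) r <= a i]; hence the bound is quadratic in the
   displacement. *)
Lemma loss_piece_le A i J : (2 <= #|A|)%N -> js \in A ->
  \sum_(o | [&& js \notin next_set A o, o.1.1 == i & xside o A == J]) w o <=
  d%:R^-1 * (3 * a i * pc i J / (eps * r A ^+ 2)).
Proof.
move=> A2 jA; have r0 : 0 < r A by exact: (radius_gt0 _ c_inj n_gt0 n_large).
have a0 i' : 0 <= a i' by exact: normr_ge0.
have L0 : 0 <= 3 * a i * pc i J / (eps * r A ^+ 2).
  by rewrite divr_ge0 ?mulr_ge0 ?piece_ge0 ?sqr_ge0//; exact: ltW.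
apply: le_trans (@sum_weight_diam _ _ _ c med eps x _
   (fun i' => if i' == i then 3 * a i * pc i J / (eps * r A ^+ 2) else 0) _ _) _.
- by move=> i'; case: ifP.
- move=> i' s th th' /andP[th0 _] /andP[th'0 _] tt.
  move=> /and3P[l1 /= /eqP ii /eqP sJ] /and3P[l2 /= _ /eqP sJ']; rewrite ii eqxx.
  have [_ _ /=] := lostP jA l1; have [_ _ /=] := lostP jA l2.
  rewrite sJ sJ' ii /low_centers /high_centers -!mulrA -/(r A).
  set T := Num.sqrt th * r A; set T' := Num.sqrt th' * r A => H1 H2.
  have T0 : 0 <= T by rewrite mulr_ge0 ?sqrtr_ge0// ltW.
  have TT : T <= T' by rewrite ler_pM2r// ler_wsqrtr.
  have eT : 0 <= eps * T by rewrite mulr_ge0// ltW.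
  have eT' : 0 <= eps * T' by rewrite mulr_ge0//; [exact: ltW|lra].
  have eTT : 0 <= eps * (T' - T) by rewrite mulr_ge0//; [exact: ltW|lra].
  have e1 : eps * (T' - T) <= 1 / 320 * (T' - T) by rewrite ler_wpM2r//; lra.
  (* The shifted positions move at speed at least [1 - eps >= 2 / 3] in [T], and both belong to the
     piece of [J]. The margin [eps * T'] fits between [x] and the center. *)
  have key : T' - T <= 3 / 2 * pc i J /\ eps * T' <= a i.
    case: H2 => -[h1 [h2 h3]]; case: H1 => -[h1' [h2' h3']].
    - have xc : x ord0 i < c js ord0 i by move: h1 h2; case: (s); rewrite /sign_of; lra.
      have aE : a i = c js ord0 i - x ord0 i by rewrite /a distrC gtr0_norm// subr_gt0.
      have B1 : between (x ord0 i) (c js ord0 i) (med A ord0 i + (sign_of R s + eps) * T).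
        by rewrite /between xc/= in_itv/=; apply/andP; split => //; lra.
      have B2 : between (x ord0 i) (c js ord0 i) (med A ord0 i + (sign_of R s + eps) * T').
        by rewrite /between xc/= in_itv/=; apply/andP; split => //; lra.
      have S1 : y_side (fun j => c j ord0 i) (x ord0 i) (c js ord0 i)
          (med A ord0 i + (sign_of R s + eps) * T) = J by rewrite /y_side xc.
      have S2 : y_side (fun j => c j ord0 i) (x ord0 i) (c js ord0 i)
          (med A ord0 i + (sign_of R s + eps) * T') = J by rewrite /y_side xc.
      split; last by rewrite aE; lra.
      move: B1 B2 S1 S2; case: (s); rewrite /sign_of => B1 B2 S1 S2.
        have H := piece_convex _ B1 B2 S1 S2; rewrite -/(pc i J) in H.
        by have := H _; lra.
      have H := piece_convex _ B2 B1 S2 S1; rewrite -/(pc i J) in H.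
      by have := H _; lra.
    (* The order of [x] and the center in coordinate [i] fixes the side of [x], so the two values of
       [theta] cannot disagree on it. *)
    - by exfalso; move: h1 h2 h1' h2'; case: (s); rewrite /sign_of; lra.
    - by exfalso; move: h1 h2 h1' h2'; case: (s); rewrite /sign_of; lra.
    - have cx : c js ord0 i < x ord0 i by move: h1 h2; case: (s); rewrite /sign_of; lra.
      have xc : (x ord0 i < c js ord0 i) = false by apply/negbTE; rewrite -leNgt ltW.
      have aE : a i = x ord0 i - c js ord0 i by rewrite /a gtr0_norm// subr_gt0.
      have B1 : between (x ord0 i) (c js ord0 i) (med A ord0 i + (sign_of R s - eps) * T).
        by rewrite /between xc/= in_itv/=; apply/andP; split => //; lra.
      have B2 : between (x ord0 i) (c js ord0 i) (med A ord0 i + (sign_of R s - eps) * T').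
        by rewrite /between xc/= in_itv/=; apply/andP; split => //; lra.
      have S1 : y_side (fun j => c j ord0 i) (x ord0 i) (c js ord0 i)
          (med A ord0 i + (sign_of R s - eps) * T) = J by rewrite /y_side xc.
      have S2 : y_side (fun j => c j ord0 i) (x ord0 i) (c js ord0 i)
          (med A ord0 i + (sign_of R s - eps) * T') = J by rewrite /y_side xc.
      split; last by rewrite aE; lra.
      move: B1 B2 S1 S2; case: (s); rewrite /sign_of => B1 B2 S1 S2.
        have H := piece_convex _ B1 B2 S1 S2; rewrite -/(pc i J) in H.
        by have := H _; lra.
      have H := piece_convex _ B2 B1 S2 S1; rewrite -/(pc i J) in H.
      by have := H _; lra.
  case: key => k1 k2.
  have H := @theta_diff _ th th' (r A) (3 / 2 * pc i J) (a i / eps) r0 th0 tt.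
  apply: le_trans (H _ _ _) _; rewrite -/T -/T'.
  + by rewrite mulr_ge0// piece_ge0.
  + by lra.
  + by rewrite ler_pdivlMr// mulrC.
  by rewrite le_eqVlt; apply/orP; left; apply/eqP; field; rewrite !gt_eqF.
rewrite ler_wpM2l ?invr_ge0//.
by rewrite (bigD1 i)//= eqxx big1 ?addr0// => i' /negbTE ->.
Qed.

End FinePotential.

(** * The logarithmic potential *)

Section RefinedPotential.
Variables (R : realType) (d k : nat) (c : 'I_k -> 'rV[R]_d) (med : {set 'I_k} -> 'rV[R]_d).
Variables (eps : R) (x : 'rV[R]_d) (n : nat) (js : 'I_k).
Hypothesis eps_gt0 : 0 < eps.
Hypothesis eps_le : eps <= 1 / 320.
Hypothesis medP : forall S : {set 'I_k}, (0 < #|S|)%N -> is_median c S (med S).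
Hypothesis c_inj : injective c.
Hypothesis n_gt0 : (0 < n)%N.
Hypothesis n_large : (8 * k ^ 2 <= 4 ^ n)%N.
Hypothesis d_gt0 : (0 < d)%N.
Hypothesis js_nearest : forall j, sqdist x (c js) <= sqdist x (c j).
Implicit Types A B J : {set 'I_k}.

Let w := weight c med eps x.
Let r A := cell_radius c med A.
Let rho j := dist2 x (c j).
Let a i := `|x ord0 i - c js ord0 i|.
Let pc i J := piece (fun j => c j ord0 i) (x ord0 i) (c js ord0 i) J.
Let D A := spread c n A.

Let w0 o : 0 <= w o. Proof. exact: weight_ge0. Qed.
Let sum_w : \sum_o w o = 1. Proof. exact: sum_weight. Qed.

(** The crude bound [4 * rho ^+ 2 + crude_factor * rho * D] is at most [cutoff * rho * D] once
    [rho <= 2 * D]; the 8 absorbs the quadratic term. *)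
Definition cutoff : R := 8 + crude_factor R n.

(** For positive distances this is the savings at the center of [A] nearest to [x]. As a maximum, it
    visibly cannot increase when [A] shrinks, and it vanishes on the empty set. *)
Definition best A (t : R) : R := \big[Num.max/0]_(j in A) savings cutoff t (dist2 x (c j)).

Definition gain A : R := \sum_i \sum_J
  a i * pc i J * best (A :&: J) (spread c n A).

(** Chosen so that [gain_factor * rate = 48 * 32 / d]. Here [48 = 3 * 16] combines the constant of
    [loss_piece_le] with [r^-2 <= 16 / D^2], and 32 is the constant of [cost_le_decrease]. *)
Definition gain_factor : R := 96 * 32 * 32 * n.*2%:R.

Definition refined A : R :=
  if js \in A then 4 * sqdist x (c js) + gain_factor / eps * gain A else crude c x n A.

Let cutoff_ge8 : 8 <= cutoff. Proof. by rewrite lerDl crude_factor_ge0. Qed.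
Let cutoff_ge1 : 1 <= cutoff. Proof. by apply: le_trans cutoff_ge8; rewrite ler1n. Qed.

Let rho_le j : rho js <= rho j. Proof. exact: ler_wsqrtr. Qed.

Let rhoX j : rho j ^+ 2 = sqdist x (c j). Proof. exact: dist2X. Qed.

Let rho0 j : 0 <= rho j. Proof. exact: dist2_ge0. Qed.

Let a0 i : 0 <= a i. Proof. exact: normr_ge0. Qed.

Let rho_gt0 i j : a i != 0 -> 0 < rho j.
Proof.
move=> ai; apply: lt_le_trans (rho_le j); apply: lt_le_trans (coord_le_dist2 x (c js) i).
by rewrite lt_def ai a0.
Qed.

Let best_ge0 A t : 0 <= best A t. Proof. exact: bigmax_ge_id. Qed.

Let wgt_ge0 i J : 0 <= a i * pc i J. Proof. by rewrite mulr_ge0// piece_ge0. Qed.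

Lemma gain_ge0 A : 0 <= gain A.
Proof. by do 2![apply: sumr_ge0 => ? _]; rewrite mulr_ge0. Qed.

Let factor_ge0 : 0 <= gain_factor / eps.
Proof. by rewrite divr_ge0 ?(ltW eps_gt0)// !mulr_ge0. Qed.

Lemma refined_ge0 A : 0 <= refined A.
Proof.
rewrite /refined; case: ifP => _; last exact: crude_ge0.
apply: addr_ge0; first by rewrite mulr_ge0 ?sqdist_ge0.
by apply: mulr_ge0; [exact: factor_ge0|exact: gain_ge0].
Qed.

Lemma sqdist_le_refined j : sqdist x (c j) <= refined [set j].
Proof.
rewrite /refined inE; case: eqP => [<-|_]; last exact: sqdist_le_crude.
have := mulr_ge0 factor_ge0 (gain_ge0 [set js]); have := sqdist_ge0 x (c js); lra.
Qed.

Lemma gain_le A : gain A <= ln cutoff * sqdist x (c js).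
Proof.
apply: (@le_trans _ _ (\sum_i \sum_J a i * pc i J * ln cutoff)).
  apply: ler_sum => i _; apply: ler_sum => J _.
  (* The bound on [savings] needs positive distances; they are guaranteed by [a i != 0], and
     otherwise the weight vanishes. *)
  have [E|ai] := eqVneq (a i) 0; first by rewrite E !mul0r.
  rewrite ler_wpM2l//; apply: bigmax_le; first exact: ln_ge0.
  by move=> j _; apply: savings_le; rewrite ?spread_ge0// (rho_gt0 _ ai).
rewrite le_eqVlt; apply/orP; left; apply/eqP; rewrite mulr_sumr; apply: eq_bigr => i _.
rewrite -mulr_suml -mulr_sumr sum_piece mulrC -/(a i); congr (_ * _).
by rewrite -expr2 /a real_normK ?num_real.
Qed.

Let slope_ge0 (Q Dv rv : R) : 1 <= Q -> 0 <= Dv -> 0 < rv ->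
  0 <= (Q - 1) * rv / ((rv + Dv) * (Q * rv + Dv)).
Proof.
move=> Q1 D0 r0; have Q0 : 0 <= Q by lra.
have Qr : 0 <= Q * rv by apply: mulr_ge0 => //; exact: ltW.
by apply: divr_ge0; apply: mulr_ge0; lra.
Qed.

(** Shrinking the set only removes candidates no better than [j0], so the new value is at most the
    savings at [j0] for the new spread. The tangent in [D] then turns the contraction of the spread
    into a decrease. *)
Lemma best_contraction A J j0 : j0 \in A :&: J ->
  (forall j, j \in A :&: J -> rho j0 <= rho j) -> 0 < rho j0 ->
  \sum_o w o * best (next_set A o :&: J) (D (next_set A o)) <=
  best (A :&: J) (D A) - rate R d n * (D A *
     ((cutoff - 1) * rho j0 / ((rho j0 + D A) * (cutoff * rho j0 + D A)))).
Proof.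
move=> j0A near r0; set slope := _ / _.
have D0 B : 0 <= D B by exact: spread_ge0.
have slope0 : 0 <= slope by exact: slope_ge0.
apply: (@le_trans _ _ (\sum_o w o * (savings cutoff (D A) (rho j0) +
    (D (next_set A o) - D A) * slope))).
  apply: ler_sum => o _; rewrite ler_wpM2l//.
  apply: le_trans (savings_tangent cutoff_ge1 (D0 A) (D0 (next_set A o)) r0).
  apply: bigmax_le; first exact: savings_ge0.
  move=> j; rewrite inE => /andP[jA jJ].
  have jAJ : j \in A :&: J by rewrite inE jJ andbT (fintype.subsetP (next_set_sub A o)).
  by apply: savings_anti => //; exact: near.
have -> : \sum_o w o * (savings cutoff (D A) (rho j0) + (D (next_set A o) - D A) * slope) =
   savings cutoff (D A) (rho j0) + (\sum_o w o * D (next_set A o) - D A) * slope.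
  rewrite (eq_bigr (fun o => w o * (savings cutoff (D A) (rho j0) - D A * slope) +
    w o * D (next_set A o) * slope)); last by move=> o _; ring.
  by rewrite big_split/= -!(mulr_suml, mulr_suml) sum_w; ring.
have H := spread_contraction x eps_gt0 eps_le medP c_inj n_gt0 n_large d_gt0 A.
have H' : \sum_o w o * D (next_set A o) - D A <= - rate R d n * D A.
  by rewrite /D /w; lra.
have := ler_wpM2r slope0 H'.
have : savings cutoff (D A) (rho j0) <= best (A :&: J) (D A).
  exact: (le_bigmax_cond _ (fun j => savings cutoff (D A) (dist2 x (c j)))).
by lra.
Qed.

(* A loss of the nearest center, together with its cost, is paid for by the
   decrease of the logarithmic potential. *)
Let cost_le_decrease (Dv rv Q X : R) : 0 < Dv -> 0 < rv -> rv <= 2 * Dv -> 8 <= Q ->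
  0 <= X -> X <= 4 * Dv ^+ 2 -> X <= Q * rv * Dv ->
  X / Dv ^+ 2 <= 32 * (Dv * ((Q - 1) * rv / ((rv + Dv) * (Q * rv + Dv)))).
Proof.
move=> D0 r0 rD Q8 X0 X1 X2; have Q0 : 0 < Q by lra.
have Qr0 : 0 < Q * rv by rewrite mulr_gt0.
have s0 : 0 < rv + Dv by lra.
have s1 : 0 < Q * rv + Dv by lra.
rewrite ler_pdivrMr ?exprn_gt0//.
have -> : 32 * (Dv * ((Q - 1) * rv / ((rv + Dv) * (Q * rv + Dv)))) * Dv ^+ 2 =
  (32 * (Q - 1) * rv * Dv ^+ 3) / ((rv + Dv) * (Q * rv + Dv)).
  by field; rewrite !gt_eqF.
rewrite ler_pdivlMr ?mulr_gt0//.
have QM : 0 <= (Q - 8) * rv * Dv ^+ 3 by rewrite !mulr_ge0 ?exprn_ge0//; lra.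
have rD3 : 0 <= rv * Dv ^+ 3 by rewrite mulr_ge0 ?exprn_ge0; lra.
apply: (@le_trans _ _ (X * (3 * Dv * (Q * rv + Dv)))).
  by rewrite ler_wpM2l// ler_wpM2r//; lra.
(* When [Q * rv <= Dv] the crude bound [Q * rv * Dv] is used, otherwise the trivial bound
   [4 * Dv ^+ 2]. *)
have [QD|/ltW QD] := lerP (Q * rv) Dv.
  apply: (@le_trans _ _ (Q * rv * Dv * (3 * Dv * (2 * Dv)))).
    by apply: ler_pM => //; [rewrite !mulr_ge0; lra|rewrite ler_wpM2l; lra].
  by lra.
apply: (@le_trans _ _ (4 * Dv ^+ 2 * (3 * Dv * (2 * (Q * rv))))).
  by apply: ler_pM => //; [rewrite !mulr_ge0; lra|rewrite ler_wpM2l; lra].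
by lra.
Qed.

(** What the crude bound costs beyond the constant term [4 * sqdist x (c js)] that [refined] already
    carries. *)
Let excess A := Num.max 0 (crude c x n A - 4 * sqdist x (c js)).

Let excess_ge0 A : 0 <= excess A. Proof. by rewrite le_max lexx. Qed.

Let loss i J A := \sum_(o | [&& js \notin next_set A o, o.1.1 == i & xside o A == J]) w o.

Let nextE A (o : outcome d k) : js \in A -> js \notin next_set A o ->
  next_set A o = A :&: xside o A /\ A :&: xside o A != finset.set0.
Proof.
move=> jA; rewrite /next_set; case: ifP => [/and3P[_ L H] _|_]; last by rewrite jA.
by split => //; rewrite /xside; case: ifP.
Qed.

(** The balance holds separately for each coordinate and class: the loss probability is
    [O(W / (eps d r^2))] with [W] the weight of the class, and the same [W] multiplies the decrease
    of [best], so that [cost_le_decrease] compares the two. *)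
Lemma loss_paid A i J : js \in A ->
  loss i J A * excess (A :&: J) +
    gain_factor / eps * (a i * pc i J) * \sum_o w o * best (next_set A o :&: J) (D (next_set A o)) <=
  gain_factor / eps * (a i * pc i J) * best (A :&: J) (D A).
Proof.
move=> jA.
have [A2|A2] := leqP 2 #|A|; last first.
  have -> : loss i J A = 0 by rewrite /loss big_pred0// => o; rewrite next_set_small// jA.
  rewrite mul0r add0r (eq_bigr (fun o => w o * best (A :&: J) (D A))).
    by rewrite -mulr_suml sum_w mul1r.
  by move=> o _; rewrite next_set_small.
have [AJ|[j1 j1A]] := set_0Vmem (A :&: J).
  have -> : loss i J A = 0.
    rewrite /loss big_pred0// => o; apply/negbTE/negP => /and3P[jN _ /eqP E].
    by have [_] := nextE jA jN; rewrite E AJ eqxx.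
  rewrite mul0r add0r big1.
    rewrite mulr0; apply: mulr_ge0; last exact: best_ge0.
    by apply: mulr_ge0; [exact: factor_ge0|exact: wgt_ge0].
  move=> o _; rewrite (_ : _ :&: J = finset.set0) ?/best ?big_set0 ?mulr0//.
  apply/eqP; rewrite -finset.subset0 -AJ; apply: finset.setSI; exact: next_set_sub.
have lossle := loss_piece_le med x eps_gt0 eps_le c_inj n_gt0 n_large i J A2 jA.
have loss0 : 0 <= loss i J A by apply: sumr_ge0.
have r0 : 0 < r A by exact: (radius_gt0 _ c_inj n_gt0 n_large).
have dR : (0 : R) < d%:R by rewrite ltr0n.
set W := a i * pc i J.
have lossW : loss i J A <= d%:R^-1 * (3 * W / (eps * r A ^+ 2)).
  by rewrite /W [3 * _]mulrA; exact: lossle.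
have [W0|Wn0] := eqVneq W 0.
  have -> : loss i J A = 0.
    by apply/eqP; rewrite eq_le loss0 andbT; move: lossW; rewrite W0 mulr0 mul0r mulr0.
  by rewrite W0 mul0r mulr0 !mul0r addr0.
have ai0 : a i != 0 by apply: contra Wn0 => /eqP E; rewrite /W E mul0r.
have [j0 j0A near] : exists2 j0, j0 \in A :&: J & forall j, j \in A :&: J -> rho j0 <= rho j.
  by case: (Order.TotalTheory.arg_minP rho j1A) => j0 H1 H2; exists j0.
have rj0 : 0 < rho j0 by exact: rho_gt0 ai0.
have BC := best_contraction j0A near rj0; move: BC.
set slope := _ / ((_ + _) * _) => BC.
have D0 : 0 < D A by exact: spread_gt0.
have Dr : D A <= 4 * r A by exact: spread_le_radius.
have Wf0 : 0 <= gain_factor / eps * W.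
  by apply: mulr_ge0; [exact: factor_ge0|exact: wgt_ge0].
apply: le_trans (lerD (lexx _) (ler_wpM2l Wf0 BC)) _.
rewrite mulrBr addrCA gerDl subr_le0.
have NR : (0 : R) < (n.*2)%:R by rewrite ltr0n double_gt0.
have FR : gain_factor * rate R d n = 48 * 32 / d%:R.
  by rewrite /gain_factor /rate; field; rewrite !gt_eqF.
have key : excess (A :&: J) / D A ^+ 2 <= 32 * (D A * slope).
  have js_sq := rhoX js; have r00 := rho0 js.
  have farA := far_le_spread c x n_gt0 jA; rewrite -/(D A) -js_sq in farA.
  have cf : crude c x n (A :&: J) <= far c x A.
    by apply: le_trans (crude_le_far _ _ _ _) (le_far _ _ (finset.subsetIl _ _)).
  have [Dle|Dgt] := lerP (D A) (rho js).
    have DD : D A ^+ 2 <= rho js ^+ 2 by rewrite lerXn2r ?nnegrE// ltW.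
    have -> : excess (A :&: J) = 0 by apply: max_l; rewrite -js_sq; lra.
    by rewrite mul0r; do 2![apply: mulr_ge0 => //]; [exact: ltW|apply: slope_ge0 => //; exact: ltW].
  have DD : rho js ^+ 2 <= D A ^+ 2 by rewrite lerXn2r ?nnegrE// ltW.
  have e1 : excess (A :&: J) <= Num.max 0 (crude c x n (A :&: J)).
    by rewrite /excess ge_max !le_max lexx/= gerDl -js_sq oppr_le0 mulr_ge0 ?sqr_ge0 ?orbT.
  have e2 : excess (A :&: J) <= crude c x n (A :&: J).
    apply: le_trans e1 _; rewrite ge_max lexx andbT; exact: crude_ge0.
  (* All of [A] lies within [2 * D A] of [x], because [far] is at most [2 rho^2 + 2 D^2] and here
     [rho js] is below [D A]. *)
  have rj2 : rho j0 <= 2 * D A.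
    rewrite -(@ler_pXn2r _ 2) ?nnegrE ?mulr_ge0//; last exact: ltW.
    have : sqdist x (c j0) <= far c x A.
      apply: (le_bigmax_cond _ (fun j => sqdist x (c j))).
      by move: j0A; rewrite inE => /andP[].
    by rewrite -rhoX exprMn; lra.
  apply: cost_le_decrease => //.
    by apply: le_trans e2 (le_trans cf _); lra.
  apply: le_trans e2 _; apply: le_trans (crude_le_bound c x n j0A) _.
  rewrite /crude_bound -rhoX.
  have sp : spread c n (A :&: J) <= D A by apply: le_spread => //; exact: finset.subsetIl.
  have Kr0 : 0 <= crude_factor R n * rho j0 by rewrite mulr_ge0 ?crude_factor_ge0.
  have := ler_wpM2l Kr0 sp; rewrite -/(rho j0).
  have : 0 <= rho j0 * (2 * D A - rho j0) by rewrite mulr_ge0//; lra.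
  by rewrite /cutoff; lra.
have D2r : (r A ^+ 2)^-1 <= 16 / D A ^+ 2.
  rewrite ler_pdivlMr ?exprn_gt0// mulrC ler_pdivrMr ?exprn_gt0//.
  have : D A ^+ 2 <= (4 * r A) ^+ 2 by rewrite lerXn2r ?nnegrE ?mulr_ge0//; exact: ltW.
  by rewrite exprMn; lra.
have Wed : 0 <= W / eps / d%:R.
  by apply: divr_ge0; [apply: divr_ge0; [exact: wgt_ge0|exact: ltW]|exact: ltW].
have lossD : loss i J A <= 48 * (W / eps / d%:R) / D A ^+ 2.
  apply: le_trans lossW _.
  have -> : d%:R^-1 * (3 * W / (eps * r A ^+ 2)) = 3 * (W / eps / d%:R) * (r A ^+ 2)^-1.
    by field; rewrite !gt_eqF.
  have -> : 48 * (W / eps / d%:R) / D A ^+ 2 = 3 * (W / eps / d%:R) * (16 / D A ^+ 2).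
    by field; rewrite !gt_eqF.
  by apply: ler_wpM2l => //; apply: mulr_ge0.
apply: le_trans (ler_wpM2r (excess_ge0 _) lossD) _.
have -> : 48 * (W / eps / d%:R) / D A ^+ 2 * excess (A :&: J) =
  48 * (W / eps / d%:R) * (excess (A :&: J) / D A ^+ 2) by ring.
have -> : gain_factor / eps * W * (rate R d n * (D A * slope)) =
  48 * (W / eps / d%:R) * (32 * (D A * slope)).
  have -> : gain_factor / eps * W * (rate R d n * (D A * slope)) =
     gain_factor * rate R d n * (W / eps * (D A * slope)) by ring.
  by rewrite FR; ring.
by apply: ler_wpM2l => //; apply: mulr_ge0.
Qed.

(** The event of losing the nearest center is decomposed by the coordinate of the cut and the kept
    side [J], matching the double sum in [gain]. *)
Lemma refined_superharmonic A : \sum_o w o * refined (next_set A o) <= refined A.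
Proof.
have [jA|jN] := boolP (js \in A); last first.
  rewrite (eq_bigr (fun o => w o * crude c x n (next_set A o))).
    rewrite /refined (negbTE jN).
    exact: (crude_superharmonic x eps_gt0 eps_le medP c_inj n_gt0 n_large d_gt0 A).
  move=> o _; rewrite /refined; case: ifP => // jn.
  by rewrite (fintype.subsetP (next_set_sub A o) _ jn) in jN.
apply: (@le_trans _ _ (\sum_o w o * (4 * sqdist x (c js) +
   gain_factor / eps * gain (next_set A o) +
   (js \notin next_set A o)%:R * excess (A :&: xside o A)))).
  apply: ler_sum => o _; rewrite ler_wpM2l// /refined.
  have [jn|jn] := boolP (js \in next_set A o); rewrite /= ?mul0r ?addr0//.
  have [E _] := nextE jA jn; rewrite mul1r -E.
  have : crude c x n (next_set A o) - 4 * sqdist x (c js) <= excess (next_set A o).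
    by rewrite le_max lexx orbT.
  have := mulr_ge0 factor_ge0 (gain_ge0 (next_set A o)).
  by lra.
have lossE : \sum_o w o * ((js \notin next_set A o)%:R * excess (A :&: xside o A)) =
    \sum_i \sum_J loss i J A * excess (A :&: J).
  rewrite (eq_bigr (fun o => \sum_i \sum_J
    if [&& js \notin next_set A o, o.1.1 == i & xside o A == J] then w o * excess (A :&: J) else 0)).
    rewrite exchange_big/=; apply: eq_bigr => i _.
    rewrite exchange_big/=; apply: eq_bigr => J _.
    by rewrite -big_mkcond/= mulr_suml.
  move=> o _; case: (_ \notin _) => /=; last by rewrite mul0r mulr0 big1// => i _; rewrite big1.
  rewrite mul1r (bigD1 o.1.1)//= (bigD1 (xside o A))//= !eqxx/=.
  rewrite big1 ?addr0; last by move=> J /negbTE; rewrite eq_sym => ->.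
  rewrite big1 ?addr0// => i /negbTE; rewrite eq_sym => E; rewrite big1// => J _.
  by rewrite E.
have gainE : \sum_o w o * gain (next_set A o) =
    \sum_i \sum_J a i * pc i J * \sum_o w o * best (next_set A o :&: J) (D (next_set A o)).
  rewrite (eq_bigr (fun o => \sum_i \sum_J
    a i * pc i J * (w o * best (next_set A o :&: J) (D (next_set A o))))).
    rewrite exchange_big/=; apply: eq_bigr => i _.
    by rewrite exchange_big/=; apply: eq_bigr => J _; rewrite mulr_sumr.
  move=> o _; rewrite mulr_sumr; apply: eq_bigr => i _; rewrite mulr_sumr.
  by apply: eq_bigr => J _; rewrite mulrCA.
have -> : \sum_o w o * (4 * sqdist x (c js) + gain_factor / eps * gain (next_set A o) +
     (js \notin next_set A o)%:R * excess (A :&: xside o A)) =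
   4 * sqdist x (c js) + gain_factor / eps * (\sum_o w o * gain (next_set A o)) +
   \sum_o w o * ((js \notin next_set A o)%:R * excess (A :&: xside o A)).
  have S4 : 4 * sqdist x (c js) = \sum_o w o * (4 * sqdist x (c js)).
    by rewrite -mulr_suml sum_w mul1r.
  rewrite [X in _ = X + _ + _]S4 mulr_sumr -!big_split/=; apply: eq_bigr => o _; ring.
rewrite /refined ifT// -addrA; apply: lerD => //; rewrite lossE gainE /gain !mulr_sumr -big_split/=.
apply: ler_sum => i _; rewrite !mulr_sumr -big_split/=; apply: ler_sum => J _.
by rewrite addrC !mulrA -[_ * a i * _]mulrA; exact: loss_paid.
Qed.

Lemma refined_le A : js \in A ->
  refined A <= (4 + gain_factor / eps * ln cutoff) * sqdist x (c js).
Proof.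
move=> jA; rewrite /refined ifT//.
have -> : (4 + gain_factor / eps * ln cutoff) * sqdist x (c js) =
  4 * sqdist x (c js) + gain_factor / eps * (ln cutoff * sqdist x (c js)) by ring.
by apply: lerD => //; apply: ler_wpM2l; [exact: factor_ge0|exact: gain_le].
Qed.

End RefinedPotential.

(** * Trees and the expected cost *)

Section Trees.
Variables (R : realType) (d k : nat) (c : 'I_k -> 'rV[R]_d) (med : {set 'I_k} -> 'rV[R]_d).
Variables (eps : R) (x : 'rV[R]_d) (n : nat).
Implicit Types (A B : {set 'I_k}) (T : ttree R d k).

Fixpoint leaves T : seq {set 'I_k} :=
  match T with
  | TLeaf A => [:: A]
  | TNode _ _ l r => leaves l ++ leaves r
  end.

Definition split_leaf (o : outcome d k) A : seq {set 'I_k} :=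
  if splits o A then [:: A :&: low o A; A :&: high o A] else [:: A].

Definition split_leaves (s : seq {set 'I_k}) (o : outcome d k) : seq {set 'I_k} :=
  flatten [seq split_leaf o A | A <- s].

Let out := outcome_of c med eps x.

Lemma round_leafE A i b th : round c med eps i th (sign_of R b) (TLeaf A) =
  if splits (out i b th) A then
    TNode i (med A ord0 i + sign_of R b * Num.sqrt th * cell_radius c med A)
      (TLeaf (A :&: low (out i b th) A)) (TLeaf (A :&: high (out i b th) A))
  else TLeaf A.
Proof.
rewrite /splits /= /divide_and_share.
have -> : A :&: low (out i b th) A = [set j in A | c j ord0 i <=
    med A ord0 i + (sign_of R b + eps) * Num.sqrt th * cell_radius c med A].
  by apply/setP => j; rewrite !inE in_low.
have -> : A :&: high (out i b th) A = [set j in A | c j ord0 i >=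
    med A ord0 i + (sign_of R b - eps) * Num.sqrt th * cell_radius c med A].
  by apply/setP => j; rewrite !inE in_high.
by rewrite -!card_gt0; case: (1 < #|A|)%N.
Qed.

Lemma leaves_round T i b th :
  leaves (round c med eps i th (sign_of R b) T) = split_leaves (leaves T) (out i b th).
Proof.
elim: T => [A|j xi l IHl r IHr]; last first.
  by rewrite /= IHl IHr /split_leaves map_cat flatten_cat.
rewrite round_leafE /split_leaves /= cats0 /split_leaf.
by case: (splits _ A).
Qed.

Lemma leaf_of_round T i b th :
  leaf_of (round c med eps i th (sign_of R b) T) x = next_set (leaf_of T x) (out i b th).
Proof.
elim: T => [A|j xi l IHl r IHr]; last by rewrite /=; case: ifP.
rewrite round_leafE [leaf_of (TLeaf A) x]/= /next_set; case: (splits _ A) => //.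
rewrite /xside (_ : ((out i b th).2 A).2 = below_cut c med x A i (sign_of R b) th).
  by rewrite /below_cut [LHS]/=; case: ifP.
by rewrite ffunE.
Qed.

Lemma haltedE T : halted T = all (fun A => (#|A| < 2)%N) (leaves T).
Proof. by elim: T => [A|j xi l IHl r IHr] /=; rewrite ?andbT// all_cat IHl IHr. Qed.

Lemma round_halted T i s th : halted T -> round c med eps i th s T = T.
Proof.
elim: T => [A|j xi l IHl r IHr] /=; first by rewrite ltnNge => /negbTE ->.
by case/andP => /IHl -> /IHr ->.
Qed.

Lemma leaf_of_halted T : halted T -> (#|leaf_of T x| < 2)%N.
Proof.
elim: T => [A|j xi l IHl r IHr] //= /andP[hl hr].
by case: ifP => _; [exact: IHl|exact: IHr].
Qed.

(** All leaves are included, not only that of [x], because the output is defined by the halting of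
    the whole tree. *)
Definition leaf_potential (s : seq {set 'I_k}) : R := \sum_(A <- s) power_sum c n A.

Lemma leaf_potential_ge0 s : 0 <= leaf_potential s.
Proof. by apply: sumr_ge0 => A _; exact: power_sum_ge0. Qed.

Hypothesis eps_gt0 : 0 < eps.
Hypothesis eps_le : eps <= 1 / 320.
Hypothesis medP : forall S : {set 'I_k}, (0 < #|S|)%N -> is_median c S (med S).
Hypothesis c_inj : injective c.
Hypothesis n_gt0 : (0 < n)%N.
Hypothesis n_large : (8 * k ^ 2 <= 4 ^ n)%N.
Hypothesis d_gt0 : (0 < d)%N.

Lemma leaf_potential_contraction s :
  \sum_o weight c med eps x o * leaf_potential (split_leaves s o) <=
  (1 - (64 * d%:R)^-1) * leaf_potential s.
Proof.
have -> : \sum_o weight c med eps x o * leaf_potential (split_leaves s o) =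
   \sum_(A <- s) \sum_o weight c med eps x o * leaf_potential (split_leaf o A).
  rewrite exchange_big/=; apply: eq_bigr => o _.
  by rewrite /leaf_potential /split_leaves big_flatten/= big_map mulr_sumr.
rewrite [in leRHS]/leaf_potential mulr_sumr; apply: ler_sum => A _.
have [A2|A2] := leqP 2 #|A|; last first.
  rewrite power_sum_eq0// mulr0 big1// => o _.
  by rewrite /split_leaf /splits leqNgt A2 /leaf_potential big_seq1 power_sum_eq0// mulr0.
apply: le_trans (power_sum_contraction x eps_gt0 eps_le medP c_inj n_gt0 n_large d_gt0 A2).
apply: ler_weight_sum => i b th /andP[th0 _]; rewrite /split_leaf /splits A2/=.
case: ifPn => [_|H]; first by rewrite /leaf_potential big_cons big_seq1.
rewrite /leaf_potential big_seq1.
by apply: power_sum_children => //; exact: ltW.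
Qed.

(** A positive threshold, as a minimum over finitely many sets, below which the potential of a tree
    that has not halted cannot fall. *)
Definition min_power_sum : R := \big[Num.min/1]_(A : {set 'I_k} | (2 <= #|A|)%N) power_sum c n A.

Lemma min_power_sum_gt0 : 0 < min_power_sum.
Proof. by apply: lt_bigmin => // A A2; exact: power_sum_gt0. Qed.

Lemma not_halted_potential T : ~~ halted T -> min_power_sum <= leaf_potential (leaves T).
Proof.
rewrite haltedE -has_predC => /hasP[A As /=]; rewrite -leqNgt => A2.
apply: (@le_trans _ _ (power_sum c n A)); first exact: bigmin_le_cond.
rewrite /leaf_potential (big_rem A)//= lerDl; apply: sumr_ge0 => B _; exact: power_sum_ge0.
Qed.

End Trees.

Section GeometricDecay.
Import numFieldNormedType.Exports.

Lemma geometric_small (R : realType) (g K e : R) : 0 <= g < 1 -> 0 < e ->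
  exists m : nat, g ^+ m * K <= e.
Proof.
move=> /andP[g0 g1] e0; pose K1 := `|K| + 1.
have K10 : 0 < K1 by rewrite ltr_wpDl.
have eK : 0 < e / K1 by rewrite divr_gt0.
have := @cvg_expr R g; rewrite ger0_norm// => /(_ g1)/cvgrPdist_le/(_ _ eK).
move=> [m _ /(_ m (leqnn m))] /=.
rewrite sub0r normrN ger0_norm ?exprn_ge0// ler_pdivlMr// => H; exists m.
apply: le_trans H; rewrite ler_wpM2l ?exprn_ge0// /K1.
by apply: le_trans (ler_norm K) _; rewrite lerDl.
Qed.

End GeometricDecay.

(** * Almost sure halting and passage to the output *)

Section ExpectedCost.
Local Open Scope classical_set_scope.
Variables (R : realType) (d k : nat) (c : 'I_k -> 'rV[R]_d) (med : {set 'I_k} -> 'rV[R]_d).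
Variables (eps : R) (x : 'rV[R]_d) (n : nat) (js : 'I_k).
Hypothesis eps_gt0 : 0 < eps.
Hypothesis eps_le : eps <= 1 / 320.
Hypothesis medP : forall S : {set 'I_k}, (0 < #|S|)%N -> is_median c S (med S).
Hypothesis c_inj : injective c.
Hypothesis n_gt0 : (0 < n)%N.
Hypothesis n_large : (8 * k ^ 2 <= 4 ^ n)%N.
Hypothesis d_gt0 : (0 < d)%N.
Hypothesis js_nearest : forall j, sqdist x (c js) <= sqdist x (c j).
Variables (dO : measure_display) (Omega : measurableType dO) (P : probability Omega R).
Variables (I : nat -> Omega -> 'I_d) (Th : nat -> Omega -> R) (Sg : nat -> Omega -> bool).
Hypothesis mI : forall t a, measurable (I t @^-1` [set a]).
Hypothesis mTh : forall t, measurable_fun setT (Th t).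
Hypothesis mSg : forall t b, measurable (Sg t @^-1` [set b]).
Hypothesis indep : forall (n : nat) (A : nat -> {set 'I_d}) (B : nat -> set R) (Cs : nat -> {set bool}),
     (forall t, measurable (B t)) ->
     P (\bigcap_(t in `I_n) [set w | I t w \in A t /\ B t (Th t w) /\ Sg t w \in Cs t])
     = (\prod_(t < n) ((#|A t|%:R / d%:R)%:E
                       * lebesgue_measure (B t `&` `]0%R, 1%R[)
                       * (#|Cs t|%:R / 2)%:E))%E.

Let o := random_outcome c med eps x I Th Sg.
Let tree m w := tree_at c med eps I Th Sg m w.
Let mo := measurable_random_outcome c med eps x mI mTh mSg.
Let iid := random_outcome_iid c med eps x indep.
Let all_centers : {set 'I_k} := [set: 'I_k]%SET.

Let leaf_chain m w : leaf_of (tree m w) x = chain o (@next_set d k) all_centers m w.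
Proof. by elim: m => //= m IH; rewrite leaf_of_round -IH. Qed.

Let leaves_chain m w : leaves (tree m w) = chain o (@split_leaves d k) [:: all_centers] m w.
Proof. by elim: m => //= m IH; rewrite (leaves_round _ _ _ x) -IH. Qed.

Let g : R := 1 - (64 * d%:R)^-1.

Let g01 : 0 <= g < 1.
Proof.
have dR : (1 : R) <= d%:R by rewrite ler1n.
have i1 : 0 < (64 * d%:R : R)^-1 by rewrite invr_gt0; lra.
have i2 : (64 * d%:R : R)^-1 <= 1 by rewrite invf_le1; lra.
by rewrite /g; apply/andP; split; lra.
Qed.

Let refined_expectation m :
  (\int[P]_w (refined c eps x n js (leaf_of (tree m w) x))%:E <=
   (refined c eps x n js all_centers)%:E)%E.
Proof.
under eq_integral do rewrite leaf_chain.
rewrite -[leRHS]mul1e -(expr1n _ m) -EFinM.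
apply: (chain_expectation_le mo iid) => //; first by move=> A; exact: refined_ge0.
by move=> A; rewrite mul1r; exact: refined_superharmonic.
Qed.

Let potential_expectation m :
  (\int[P]_w (leaf_potential c n (leaves (tree m w)))%:E <=
   (g ^+ m * power_sum c n all_centers)%:E)%E.
Proof.
under eq_integral do rewrite leaves_chain.
have -> : power_sum c n all_centers = leaf_potential c n [:: all_centers].
  by rewrite /leaf_potential big_seq1.
apply: (chain_expectation_le mo iid).
- by case/andP: g01.
- by move=> s; exact: leaf_potential_ge0.
- by move=> s; exact: leaf_potential_contraction.
Qed.

Let mpot m : measurable_fun setT (fun w => (leaf_potential c n (leaves (tree m w)))%:E).
Proof.
rewrite (_ : (fun w => _) = (fun w => (leaf_potential c n
  (chain o (@split_leaves d k) [:: all_centers] m w))%:E)).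
  exact: (measurable_chain_fun mo).
by apply/funext => w; rewrite leaves_chain.
Qed.

Let mref m : measurable_fun setT (fun w => (refined c eps x n js (leaf_of (tree m w) x))%:E).
Proof.
rewrite (_ : (fun w => _) = (fun w => (refined c eps x n js
  (chain o (@next_set d k) all_centers m w))%:E)).
  exact: (measurable_chain_fun mo).
by apply/funext => w; rewrite leaf_chain.
Qed.

Let H m := [set w | halted (tree m w)].

Let mH m : measurable (H m).
Proof.
rewrite (_ : H m = [set w | all (fun A : {set 'I_k} => (#|A| < 2)%N)
    (chain o (@split_leaves d k) [:: all_centers] m w)]).
  exact: (measurable_chain_pred mo).
by apply/seteqP; split => w; rewrite /H/= haltedE leaves_chain.
Qed.

Let never := \bigcap_m ~` H m.

Let mnever : measurable never.
Proof. by apply: bigcap_measurable => // m _; exact: measurableC. Qed.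

Let ms0 : 0 < min_power_sum c n. Proof. exact: min_power_sum_gt0. Qed.

(** On [never] the leaf potential stays above [min_power_sum] at every round, while its expectation
    decays geometrically. *)
Let never0 : P never = 0%E.
Proof.
have fP : P never \is a fin_num by exact: fin_num_measure.
have pm m : min_power_sum c n * fine (P never) <= g ^+ m * power_sum c n all_centers.
  rewrite -lee_fin EFinM fineK//; apply: le_trans (potential_expectation m).
  have PE : (\int[P]_w (\1_never w)%:E)%E = P never by rewrite integral_indic// setIT.
  apply: (@le_trans _ _ ((min_power_sum c n)%:E * \int[P]_w (\1_never w)%:E)%E); first by rewrite PE.
  rewrite -ge0_integralZl_EFin//; last exact: ltW.
    apply: ge0_le_integral => //.
    - by move=> w _; rewrite mule_ge0// lee_fin ?ltW// indicE.
    - by apply: measurable_funeM; apply/measurable_EFinP; exact: measurable_indic.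
    - move=> w _; rewrite indicE; have [/set_mem Nw|_] := boolP (w \in never).
        by rewrite mule1 lee_fin not_halted_potential//; apply/negP; exact: (Nw m Logic.I).
      by rewrite mule0 lee_fin leaf_potential_ge0.
  by apply/measurable_EFinP; exact: measurable_indic.
have fine0 : 0 <= fine (P never) by rewrite fine_ge0.
rewrite -(fineK fP); congr EFin; apply/eqP; rewrite eq_le fine0 andbT leNgt.
apply/negP => Q0; have MQ : 0 < min_power_sum c n * fine (P never) / 2.
  by rewrite divr_gt0// mulr_gt0.
have [m Hm] := geometric_small (power_sum c n all_centers) g01 MQ.
by have := pm m; lra.
Qed.

Let cost (A : {set 'I_k}) : \bar R := if [pick j in A] is Some j then (sqdist x (c j))%:E else +oo%E.

Let halted_stable m m' w : (m <= m')%N -> halted (tree m w) -> tree m' w = tree m w.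
Proof.
move=> mm hm; rewrite -(subnKC mm); elim: (m' - m)%N => [|q IH]; first by rewrite addn0.
by rewrite addnS /tree /= -/(tree _ w) IH round_halted.
Qed.

Let output_halted m w : H m w -> output_cost c med eps I Th Sg x w = cost (leaf_of (tree m w) x).
Proof.
move=> hm; rewrite /output_cost; case: pselect => [h|nh]; last first.
  by exfalso; apply: nh; exists m.
rewrite /tree_cost /cost; case: ex_minnP => q hq qmin.
by rewrite -/(tree q w) (halted_stable (qmin _ hm) hq).
Qed.

Let output_never w : never w -> output_cost c med eps I Th Sg x w = +oo%E.
Proof.
move=> nw; rewrite /output_cost; case: pselect => // -[m hm].
by exfalso; exact: (nw m Logic.I).
Qed.

Let output_ge0 w : (0 <= output_cost c med eps I Th Sg x w)%E.
Proof.
have [nw|] := pselect (never w); first by rewrite output_never.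
move=> /existsNP[m /not_implyP[_ /contrapT hm]].
by rewrite (output_halted hm) /cost; case: pickP => // j _; rewrite lee_fin sqdist_ge0.
Qed.

Let moutput : measurable_fun setT (output_cost c med eps I Th Sg x).
Proof.
move=> _ B mB; rewrite setTI.
(* Any halted round [m] may be used, minimal or not, because halted trees no longer change. *)
rewrite (_ : _ @^-1` B = (never `&` [set w | B +oo%E]) `|`
  \bigcup_m (H m `&` [set w | `[< B (cost (leaf_of (tree m w) x)) >] ])).
  apply: measurableU.
    have [bo|nbo] := pselect (B +oo%E).
      by rewrite (_ : [set w : Omega | _] = setT) ?setIT//; apply/seteqP; split.
    by rewrite (_ : [set w : Omega | _] = set0) ?setI0//; apply/seteqP; split.
  apply: bigcup_measurable => m _; apply: measurableI => //.
  rewrite (_ : [set w | _] = [set w | `[< B (cost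
     (chain o (@next_set d k) all_centers m w)) >] ]).
    exact: (measurable_chain_pred mo _ _ m (fun A => `[< B (cost A) >])).
  by apply/seteqP; split => w /=; rewrite leaf_chain.
apply/seteqP; split => w /=.
  move=> Bw; have [nw|] := pselect (never w).
    by left; split => //; rewrite -(output_never nw).
  move=> /existsNP[m /not_implyP[_ /contrapT hm]]; right; exists m => //; split => //.
  by apply/asboolP; rewrite -(output_halted hm).
case=> [[nw Bo]|[m _ [hm /asboolP Bc]]]; first by rewrite output_never.
by rewrite (output_halted hm).
Qed.

Let nonempty m w : leaf_of (tree m w) x != finset.set0.
Proof.
rewrite leaf_chain; elim: m => /= [|m IH]; last exact: next_set_neq0.
by apply/set0Pn; exists js; rewrite inE.
Qed.

Let Mx : R := \sum_j sqdist x (c j).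

Let cost_le (A : {set 'I_k}) : A != finset.set0 -> (cost A <= Mx%:E)%E.
Proof.
move=> /set0Pn[j jA]; rewrite /cost; case: pickP => [l _|/(_ j)]; last by rewrite jA.
rewrite lee_fin /Mx (bigD1 l)//= lerDl; apply: sumr_ge0 => ? _; exact: sqdist_ge0.
Qed.

(** At a halted round the refined potential of the single remaining center dominates its cost.
    Otherwise the final cost is at most [Mx], which the normalized leaf potential pays for. *)
Let output_le m w : ~ never w -> (output_cost c med eps I Th Sg x w <=
  (refined c eps x n js (leaf_of (tree m w) x))%:E +
  (Mx / min_power_sum c n)%:E * (leaf_potential c n (leaves (tree m w)))%:E)%E.
Proof.
have M0 : 0 <= Mx by apply: sumr_ge0 => ? _; exact: sqdist_ge0.
move=> /existsNP[q /not_implyP[_ /contrapT hq]].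
have [hm|nhm] := boolP (halted (tree m w)).
  rewrite (output_halted hm) -[leLHS]adde0; apply: leeD; last first.
    by rewrite mule_ge0// lee_fin ?leaf_potential_ge0// divr_ge0// ltW.
  have c2 := leaf_of_halted x hm; have ne := nonempty m w.
  have /cards1P[j ->] : #|leaf_of (tree m w) x| == 1.
    by rewrite eqn_leq -ltnS c2 card_gt0.
  rewrite /cost; case: pickP => [l|/(_ j)]; rewrite inE ?eqxx// => /eqP ->.
  by rewrite lee_fin; exact: sqdist_le_refined.
rewrite (output_halted hq); apply: le_trans (cost_le (nonempty q w)) _.
rewrite -EFinM -EFinD lee_fin -[leLHS]add0r; apply: lerD; first exact: refined_ge0.
rewrite -mulrA ler_peMr// mulrC ler_pdivlMr// mul1r.
exact: not_halted_potential.
Qed.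

Lemma expected_cost_le :
  (\int[P]_w output_cost c med eps I Th Sg x w <= (refined c eps x n js all_centers)%:E)%E.
Proof.
apply/lee_addgt0Pr => e e0.
have MM : 0 <= Mx / min_power_sum c n.
  by apply: divr_ge0; [apply: sumr_ge0 => ? _; exact: sqdist_ge0|exact: ltW].
(* The round [m] is chosen so that the expected error from trees not yet halted is at most [e]. *)
have [m Hm] := geometric_small (Mx / min_power_sum c n * power_sum c n all_centers) g01 e0.
apply: (@le_trans _ _ (\int[P]_w ((refined c eps x n js (leaf_of (tree m w) x))%:E +
  (Mx / min_power_sum c n)%:E * (leaf_potential c n (leaves (tree m w)))%:E)))%E.
  apply: ae_ge0_le_integral => //.
  - move=> w _; rewrite adde_ge0 ?mule_ge0// lee_fin ?leaf_potential_ge0 ?refined_ge0//.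
  - by apply: emeasurable_funD => //; exact: measurable_funeM.
  - exists never; split => // w /= Hw; apply: contrapT => nw; apply: Hw => _.
    exact: output_le.
rewrite ge0_integralD//; last 3 first.
- by move=> w _; rewrite lee_fin refined_ge0.
- by move=> w _; rewrite mule_ge0// lee_fin ?leaf_potential_ge0.
- exact: measurable_funeM.
apply: leeD => //.
rewrite ge0_integralZl_EFin//; last by move=> w _; rewrite lee_fin leaf_potential_ge0.
apply: le_trans (lee_wpmul2l _ (potential_expectation m)) _; first by rewrite lee_fin.
by rewrite -EFinM lee_fin mulrCA.
Qed.

End ExpectedCost.

(** * Constants *)

Section Constants.
Variable R : realType.

Lemma ln2_bounds : 1 / 2 <= ln (2 : R) <= 1.
Proof.
have l1 : ln (1 + 1 : R) <= 1 by apply: le_ln1Dx; lra.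
have l2 : ln (1 + (- (1 / 2)) : R) <= - (1 / 2) by apply: le_ln1Dx; lra.
have E : 1 + (- (1 / 2)) = 2^-1 :> R by field.
rewrite E lnV ?posrE// in l2.
by apply/andP; split; [lra|rewrite (_ : 2 = 1 + 1 :> R)].
Qed.

Lemma exponent_exists (k : nat) : (2 <= k)%N ->
  exists n : nat, [/\ (0 < n)%N, (8 * k ^ 2 <= 4 ^ n)%N & n%:R <= 8 * ln (k%:R : R)].
Proof.
(* [k <= 2 ^ up_log 2 k] gives the factor [k ^ 2], and the extra 2 in the exponent contributes
   [16 >= 8]. *)
move=> k2; have /andP[l1 l2] := ln2_bounds; exists (up_log 2 k).+2; split => //.
  have /andP[_ H] := up_log_bounds (isT : (1 < 2)%N) k2.
  have E : (4 ^ (up_log 2 k).+2 = 16 * (2 ^ up_log 2 k) ^ 2)%N.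
    rewrite -[(up_log 2 k).+2]addn2; move: (up_log 2 k) => u.
    by rewrite expnD mulnC -(expnM 2 u 2) (mulnC u) (expnM 2 2 u).
  by rewrite E leq_mul// leq_exp2r.
have /andP[H _] := up_log_bounds (isT : (1 < 2)%N) k2.
have k0 : (0 : R) < k%:R by rewrite ltr0n; lia.
have : (2 : R) ^+ (up_log 2 k).-1 <= k%:R by rewrite -natrX ler_nat ltnW.
rewrite -ler_ln ?posrE ?exprn_gt0// lnXn// -[ln 2 *+ _]mulr_natl => H'.
have u0 : (0 < up_log 2 k)%N by rewrite up_log_gt0// ltnW.
have k2' : ln (2 : R) <= ln k%:R by rewrite ler_ln ?posrE// ler_nat.
have E : (up_log 2 k).+2%:R = (up_log 2 k).-1%:R + 3 :> R by rewrite -natrD; congr (_%:R); lia.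
rewrite E; set u := (_.-1)%:R in H' *.
have := ler_wpM2l (ler0n R (up_log 2 k).-1) l1; rewrite -/u; lra.
Qed.

Lemma max_ln_bounds (l : R) : 1 <= Num.max 1 (ln l) /\ ln l <= Num.max 1 (ln l).
Proof. by split; rewrite le_max lexx ?orbT. Qed.

(** [gain_factor] contributes [ln k], [eps^-1] contributes [ln k / delta], and [cutoff], of order
    [ln k], contributes [ln ln k] through its logarithm. The maximum with 1 handles small [k]. *)
Lemma constant_bound (k n : nat) (delta eps : R) : (2 <= k)%N -> 0 < delta < 1 ->
  (0 < n)%N -> n%:R <= 8 * ln (k%:R : R) ->
  eps = Num.min (delta / (15 * ln k%:R)) (1 / 320) ->
  4 + gain_factor R n / eps * ln (cutoff R n) <=
  2 ^+ 40 / delta * ln k%:R ^+ 2 * Num.max 1 (ln (ln k%:R)).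
Proof.
move=> k2 /andP[d0 d1] n0 nl epsE; have /andP[l1 l2] := ln2_bounds.
have k2' : ln (2 : R) <= ln k%:R by rewrite ler_ln ?posrE ?ler_nat// ltr0n; lia.
set L := ln k%:R in nl epsE k2' *; set mx := Num.max 1 (ln L).
have [m1 mL] := max_ln_bounds L; rewrite -/mx in m1 mL.
have L2 : 1 / 2 <= L by lra.
have L0 : 0 < L by lra.
have N16 : n.*2%:R <= 16 * L by rewrite -muln2 natrM; lra.
have N0 : (0 : R) <= n.*2%:R by exact: ler0n.
have eps0 : 0 < eps by rewrite epsE lt_min divr_gt0//= ?mulr_gt0//; lra.
(* The two possible values are [15 * (L / delta)] and [320 <= 640 * (L / delta)]; 655 is the sum of
   the constants. *)
have einv : eps^-1 <= 655 * (L / delta).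
  have Ld : 1 / 2 <= L / delta.
    by rewrite ler_pdivlMr//; have : 0 <= (1 - delta) * L by [apply: mulr_ge0; lra]; lra.
  rewrite epsE; have [_|_] := lerP (delta / (15 * L)) (1 / 320).
    by rewrite invf_div mulrAC -mulrA; lra.
  by rewrite invf_div; lra.
have cut0 : 0 < cutoff R n.
  by rewrite /cutoff /crude_factor; lra.
have lncut : ln (cutoff R n) <= 19 * mx.
  have c1 : cutoff R n <= 2 ^+ 18 * L by rewrite /cutoff /crude_factor; lra.
  have : ln (cutoff R n) <= ln (2 ^+ 18 * L).
    by rewrite ler_ln ?posrE// mulr_gt0// exprn_gt0.
  rewrite lnM ?posrE ?exprn_gt0// lnXn// -[ln 2 *+ _]mulr_natl; lra.
have lncut0 : 0 <= ln (cutoff R n).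
  by apply: ln_ge0; rewrite /cutoff /crude_factor; lra.
have G16 : gain_factor R n <= 96 * 32 * 32 * (16 * L) by rewrite /gain_factor; lra.
have G0 : 0 <= gain_factor R n by rewrite /gain_factor !mulr_ge0.
have i0 : 0 <= eps^-1 by rewrite invr_ge0 ltW.
have H1 := ler_pM G0 i0 G16 einv.
have H2 := ler_pM (mulr_ge0 G0 i0) lncut0 H1 lncut.
apply: (@le_trans _ _ (16 * (L ^+ 2 / delta * mx) + 96 * 32 * 32 * (16 * L) * (655 * (L / delta)) * (19 * mx))).
  apply: lerD => //.
  have LL : 1 / 4 <= L ^+ 2 by have : 0 <= (L - 1 / 2) * (L + 1 / 2) by [apply: mulr_ge0; lra]; lra.
  have Ld : L ^+ 2 <= L ^+ 2 / delta.
    by rewrite ler_pdivlMr// ger_pMr ?ltW// exprn_gt0.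
  have : 0 <= (L ^+ 2 / delta) * (mx - 1) by apply: mulr_ge0; lra.
  by lra.
set X := L ^+ 2 / delta * mx.
have X0 : 0 <= X by rewrite mulr_ge0 ?divr_ge0 ?sqr_ge0//; lra.
have -> : 2 ^+ 40 / delta * L ^+ 2 * mx = 2 ^+ 40 * X by rewrite /X; ring.
have -> : 96 * 32 * 32 * (16 * L) * (655 * (L / delta)) * (19 * mx) =
  (96 * 32 * 32 * 16 * 655 * 19) * X by rewrite /X; ring.
rewrite -mulrDl; apply: ler_wpM2r => //.
by lra.
Qed.

End Constants.

Local Open Scope classical_set_scope.

Theorem theorem3 :
  exists C : nat,
  forall (R : realType) (d k : nat) (c : 'I_k -> 'rV[R]_d) (delta : R),
  (2 <= k)%N -> injective c -> 0 < delta < 1 ->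
  forall (med : {set 'I_k} -> 'rV[R]_d),
  (forall S : {set 'I_k}, (0 < #|S|)%N -> is_median c S (med S)) ->
  let eps := Num.min (delta / (15 * ln k%:R)) (1 / 320) in
  forall (dO : measure_display) (Omega : measurableType dO)
         (P : probability Omega R)
         (I : nat -> Omega -> 'I_d) (Th : nat -> Omega -> R) (Sg : nat -> Omega -> bool),
  (forall t a, measurable (I t @^-1` [set a])) ->
  (forall t, measurable_fun setT (Th t)) ->
  (forall t b, measurable (Sg t @^-1` [set b])) ->
  (* i_t uniform on 'I_d, theta_t uniform on (0,1), sigma_t uniform on {+1,-1},
     all mutually independent (product rule on every finite family of rectangles) *)
  (forall (n : nat) (A : nat -> {set 'I_d}) (B : nat -> set R) (Cs : nat -> {set bool}),
     (forall t, measurable (B t)) ->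
     P (\bigcap_(t in `I_n) [set w | I t w \in A t /\ B t (Th t w) /\ Sg t w \in Cs t])
     = (\prod_(t < n) ((#|A t|%:R / d%:R)%:E
                       * lebesgue_measure (B t `&` `]0%R, 1%R[)
                       * (#|Cs t|%:R / 2)%:E))%E) ->
  forall x : 'rV[R]_d,
  (\int[P]_w output_cost c med eps I Th Sg x w
   <= (C%:R / delta * ln k%:R ^+ 2 * Num.max 1 (ln (ln k%:R)))%:E
      * \big[Order.min/+oo]_(j < k) (sqdist x (c j))%:E)%E.
Proof.
exists (2 ^ 40)%N => R d k c delta k2 c_inj d01 med medP eps.
move=> dO Omega P I Th Sg mI mTh mSg indep x.
(* In dimension 0 all points coincide, contrary to the injectivity of [c] and [2 <= k]. *)
have d_gt0 : (0 < d)%N.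
  rewrite lt0n; apply/eqP => d0.
  have : c (Ordinal (ltnW k2)) = c (Ordinal k2).
    by apply/rowP => i; exfalso; move: (ltn_ord i); move: (nat_of_ord i) => q; rewrite d0.
  by move=> /c_inj /(congr1 val).
have /andP[ln2 _] := ln2_bounds R.
have lnk : 0 < ln (k%:R : R).
  by apply: (@lt_le_trans _ _ (ln 2)); [lra|rewrite ler_ln ?posrE ?ler_nat// ltr0n ltnW].
have /andP[delta0 _] := d01.
have eps_gt0 : 0 < eps.
  rewrite lt_min; apply/andP; split; last by lra.
  by rewrite divr_gt0// mulr_gt0.
have eps_le : eps <= 1 / 320 by rewrite ge_min lexx orbT.
have [n [n_gt0 n_large n_le]] := exponent_exists R k2.
have [js js_nearest] : exists js, forall j, sqdist x (c js) <= sqdist x (c j).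
  case: (@Order.TotalTheory.arg_minP _ _ _ (Ordinal k2) xpredT (fun j => sqdist x (c j)) isT).
  by move=> js _ H; exists js => j; exact: H.
have cb := constant_bound k2 d01 n_gt0 n_le (erefl eps).
have C0 : 0 <= (2 ^ 40)%:R / delta * ln k%:R ^+ 2 * Num.max 1 (ln (ln (k%:R : R))).
  apply: mulr_ge0; last by rewrite le_max ler01.
  by apply: mulr_ge0; [apply: divr_ge0; [exact: ler0n|exact: ltW]|exact: sqr_ge0].
apply: (le_trans (expected_cost_le eps_gt0 eps_le medP c_inj n_gt0 n_large d_gt0
  js_nearest mI mTh mSg indep)).
apply: (@le_trans _ _ (((2 ^ 40)%:R / delta * ln k%:R ^+ 2 *
    Num.max 1 (ln (ln k%:R)))%:E * (sqdist x (c js))%:E)%E); last first.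
  apply: lee_wpmul2l; first by rewrite lee_fin.
  by apply: le_bigmin => [|j _]; [exact: leey|rewrite lee_fin].
rewrite -EFinM lee_fin.
apply: (le_trans (refined_le n eps_gt0 js_nearest (finset.in_setT js))).
by apply: ler_wpM2r; [exact: sqdist_ge0|rewrite natrX].
Qed.
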